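(* Let $k$ and $c$ be positive integers, let $f(k,c) = 8k^{2}c + 10kc - 4k + 2c + 1$, and let $G$ be a finite simple graph of order $n \ge f(k,c)$. Suppose that $G$ contains $k$ pairwise vertex-disjoint $c$-chorded cycles. If $\sigma_{2}(G) \ge n$, then $G$ can be partitioned into $k$ $c$-chorded cycles, i.e., $G$ contains $k$ pairwise vertex-disjoint $c$-chorded cycles whose vertex sets cover $V(G)$.
   Context: For a graph $G$, $\sigma_{2}(G)$ denotes the minimum of $d_{G}(u)+d_{G}(v)$ over all pairs of distinct non-adjacent vertices $u,v$ of $G$; if $G$ is complete, $\sigma_{2}(G)=+\infty$. For an integer $c \ge 1$, a cycle $C$ in $G$ is a $c$-chorded cycle if $|E(G[V(C)]) \setminus E(C)| \ge c$, where $G[X]$ is the subgraph induced by $X$; edges of $E(G[V(C)]) \setminus E(C)$ are called chords of $C$. *)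

(* Defs.v *)
(* A finite simple graph is a symmetric irreflexive
   relation e on a finType T; V(G) = T. *)
From mathcomp Require Import all_boot.
Set Implicit Arguments. Unset Strict Implicit. Unset Printing Implicit Defensive.

Section Graphs.
Variable T : finType.
Variable e : rel T.

Definition deg (u : T) : nat := #|[set v | e u v]|.

(* sigma_2(G) >= m : every pair of distinct non-adjacent vertices has
   degree sum >= m (vacuous when G is complete, matching sigma_2 = +oo). *)
Definition sigma2_ge (m : nat) : Prop :=
  forall u v : T, u != v -> ~~ e u v -> m <= deg u + deg v.

Definition is_cycle (s : seq T) : bool :=
  [&& uniq s, 2 < size s & cycle e s].

Definition cycle_edge (s : seq T) (x y : T) : bool :=
  (y == next s x) || (x == next s y).

Definition chords (s : seq T) : {set {set T}} :=
  [set E : {set T} | [exists x, exists y,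
     [&& x \in s, y \in s, e x y, ~~ cycle_edge s x y & E == [set x; y]]]].

Definition c_chorded (c : nat) (s : seq T) : bool :=
  is_cycle s && (c <= #|chords s|).

End Graphs.

Definition fkc (k c : nat) : nat := 8 * k ^ 2 * c + 10 * k * c - 4 * k + 2 * c + 1.

(* Main.v *)
(* Take k disjoint c-chorded cycles whose union L is as large as possible and suppose that
   H = V(G) - L is nonempty. No path of H can be inserted into a cycle, so each u in H is adjacent
   to at most |L|/2 vertices of L; hence H satisfies Ore's condition, has diameter at most 2, and
   of two consecutive vertices of a cycle at most one is attached to H. A vertex b of L that is
   not attached to H satisfies d_L(b) > |L| - d_L(u) for all u in H.

   Every u in H has at most 2c + 1 neighbours on each cycle C: fix c chords of C; otherwise u has
   two neighbours x1, x2 on C whose following runs of unattached vertices avoid the ends of these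
   chords. A run which the other cycles can absorb entirely may be replaced by a path of H; if
   neither can be absorbed, the first vertices s1, s2 that are not absorbable have large degree sum
   on the rest of C, and an Ore crossing on the path s1 .. x2 u x1 .. s2 closes a new cycle. All
   rerouting takes place in the graph without the c chords, so that they remain chords.

   Hence d_L(u) is at most k(2c + 1). As n is large, some cycle C is long (were H the largest
   part, H itself would be a c-chorded cycle by Ore's theorem, against the choice of L), and its
   unattached vertices miss fewer than d_L(u) vertices of L. So C has at most one attached vertex
   and is otherwise nearly complete: one or two other cycles, joined by a path through H, can be
   inserted into C after as many small c-chorded cycles have been split off from C. This
   contradicts the maximality of L. *)
Require Import Defs.
From mathcomp Require Import all_boot zify.
From Stdlib Require Import Classical_Prop.
Set Implicit Arguments. Unset Strict Implicit. Unset Printing Implicit Defensive.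

(** * Maxima of bounded predicates, and counting along sequences *)

Lemma ex_max_nat (P : nat -> Prop) (M n0 : nat) :
  P n0 -> (forall n, P n -> n <= M) ->
  exists n, P n /\ forall m, P m -> m <= n.
Proof.
move=> Pn0 leM; move E: (M - n0) => d.
elim/ltn_ind: d n0 Pn0 E => d IH n0 Pn0 E.
case: (classic (exists m, P m /\ n0 < m)) => [[m [Pm lt_m]] | no].
  by apply: (IH (M - m) _ m) => //; have := leM _ Pm; lia.
exists n0; split=> // m Pm; rewrite leqNgt; apply/negP => lt_m.
by apply: no; exists m.
Qed.

Section Lists.
Variable T : eqType.

(** Pigeonhole over the [size t] consecutive pairs of [a :: t]: [belast a t] lists their first
    entries, [t] their second ones. *)
Lemma crossing (f g : pred T) (a : T) (t : seq T) :
  size t < count f (belast a t) + count g t ->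
  exists l z z' r, [/\ a :: t = l ++ z :: z' :: r, f z & g z'].
Proof.
elim: t a => [|b t IH] a //=.
case: (boolP (f a && g b)) => [/andP[fa gb] _ | nab h].
  by exists [::], a, b, t.
have {}h : size t < count f (belast b t) + count g t.
  by move: nab h; case: (f a); case: (g b) => //=; lia.
have [l [z [z' [r [-> fz gz']]]]] := IH _ h.
by exists (a :: l), z, z', r.
Qed.

Lemma count_take_find (X : pred T) (s : seq T) : count X (take (find X s) s) = 0.
Proof. by elim: s => //= x s IH; case: ifP => //= ->. Qed.

(** The stretches between successive elements of [X] are disjoint, and each one that meets [K] uses
    up an element of [K] of its own. The stretch after [x] is [take (find X w) w], which is all of
    [w] if [X] does not occur again. *)
Lemma one_free (X K : pred T) (s : seq T) :
  count K s < count X s ->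
  exists s0 x w, [/\ s = s0 ++ x :: w, X x & ~~ has K (take (find X w) w)].
Proof.
move E: (size s) => m; elim/ltn_ind: m s E => m IH [|y s] /= E //.
case: (ltnP (count K s) (count X s)) => [lt _ | le h].
  have [|s0 [x [w [-> Xx nf]]]] := IH (size s) _ s erefl lt; first by lia.
  by exists (y :: s0), x, w.
have [Xy eqc] : X y /\ count X s = count K s by move: h; case: (X y); case: (K y) => /=; lia.
case: (boolP (has K (take (find X s) s))) => [hK|nK]; last by exists [::], y, s.
have cX := count_take_find X s.
have := count_cat X (take (find X s) s) (drop (find X s) s).
have := count_cat K (take (find X s) s) (drop (find X s) s).
rewrite cat_take_drop; move: hK; rewrite has_count => hK eK eX.
have [||s0 [x [w [eqs Xx nf]]]] := IH (size (drop (find X s) s)) _ (drop (find X s) s) erefl.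
- by rewrite size_drop; lia.
- by lia.
exists (y :: take (find X s) s ++ s0), x, w; split=> //.
by rewrite /= -catA -eqs cat_take_drop.
Qed.

Lemma two_free (X K : pred T) (s : seq T) :
  count K s + 1 < count X s ->
  exists s0 x1 w1 x2 w2,
    [/\ s = s0 ++ x1 :: w1 ++ x2 :: w2, X x1, X x2,
        ~~ has K (take (find X w1) w1) & ~~ has K (take (find X w2) w2)].
Proof.
move E: (size s) => m; elim/ltn_ind: m s E => m IH [|y s] /= E //.
case: (ltnP (count K s + 1) (count X s)) => [lt _ | le h].
  have [|s0 [x [w [x2 [w2 [-> Xx nf]]]]]] := IH (size s) _ s erefl lt; first by lia.
  by exists (y :: s0), x, w, x2, w2.
have [Xy eqc] : X y /\ count X s = (count K s).+1.
  by move: h; case: (X y); case: (K y) => /=; lia.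
(* A free stretch after [y] serves as the first and [one_free] finds the second. Otherwise the
   blocked stretch is dropped with [y], at the cost of one element of [X] and at least one of
   [K]. *)
case: (boolP (has K (take (find X s) s))) => [hK|nK]; last first.
  have [|s0 [x [w [eqs Xx nf]]]] := @one_free X K s; first by lia.
  exists [::], y, s0, x, w; split=> //=; first by rewrite eqs.
  move: nK; rewrite eqs find_cat; case: ifP => hX.
    by rewrite takel_cat // ltnW // -has_find.
  rewrite /= Xx addn0 take_size_cat // => ?.
  by rewrite take_oversize // hasNfind // hX.
have cX := count_take_find X s.
have := count_cat X (take (find X s) s) (drop (find X s) s).
have := count_cat K (take (find X s) s) (drop (find X s) s).
rewrite cat_take_drop; move: hK; rewrite has_count => hK eK eX.
have [||s0 [x [w [x2 [w2 [eqs Xx nf]]]]]] :=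
  IH (size (drop (find X s) s)) _ (drop (find X s) s) erefl.
- by rewrite size_drop; lia.
- by lia.
exists (y :: take (find X s) s ++ s0), x, w, x2, w2; split=> //.
by rewrite /= -catA -eqs cat_take_drop.
Qed.

Lemma count_next_belast (f : pred T) a t :
  count f (belast a t) + f (last a t) = count f (a :: t).
Proof. by elim: t a => [|b t IH] a //=; [rewrite addnC | rewrite -addnA IH]. Qed.

End Lists.

(** * Cycles *)

Section Cycles.
Variable T : finType.
Variable e : rel T.
Hypothesis esym : symmetric e.
Hypothesis eirr : irreflexive e.

Lemma is_cycle_rot i s : is_cycle e (rot i s) = is_cycle e s.
Proof. by rewrite /is_cycle rot_uniq size_rot rot_cycle. Qed.

Lemma rev_path_sym a t : path e (last a t) (rev (belast a t)) = path e a t.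
Proof. by rewrite rev_path; apply: eq_path => x y; rewrite esym. Qed.

(** Ore's crossing: the degree sum is at least the number of vertices, so some edge [z z'] of the
    path has [z] adjacent to the last vertex and [z'] to the first. Reversing the part from [z'] on
    closes the path. *)
Lemma path_close a t :
  path e a t -> uniq (a :: t) -> 1 < size t ->
  size t < count (e a) (a :: t) + count (e (last a t)) (a :: t) ->
  exists s, perm_eq s (a :: t) /\ is_cycle e s.
Proof.
move=> pt ut st; rewrite -(count_next_belast (e (last a t))) eirr addn0 /= eirr add0n addnC.
case/crossing=> l [z [z' [r [E ez ez']]]].
have la : last a t = last z' r by rewrite -[last a t]/(last a (a :: t)) E last_cat.
exists (l ++ z :: rev (z' :: r)); split.
  by rewrite E perm_cat2l perm_cons perm_rev.
have pz : perm_eq (l ++ z :: rev (z' :: r)) (a :: t).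
  by rewrite E perm_cat2l perm_cons perm_rev.
apply/and3P; split; rewrite ?(perm_uniq pz) ?(perm_size pz) //.
rewrite la in ez.
have [h1 h2] : path e z (rev (z' :: r)) /\ last z (rev (z' :: r)) = z'.
  rewrite rev_cons last_rcons; split=> //.
  rewrite -rev_cons lastI rev_rcons /= esym ez rev_path_sym.
  have : path e a t by [].
  case: l E {pz} => [|b l] /= [_ ->]; first by case/andP.
  by rewrite cat_path /= => /and4P[].
case: l E {pz} => [|b l] /= [ea et].
  by subst z; rewrite rcons_path h1 h2 /= esym ez'.
subst b; rewrite rcons_path cat_path last_cat /= h1 h2 (esym z') ez' !andbT.
move: pt; rewrite et cat_path /= => /and3P[p1 p2 _].
by rewrite p1 p2.
Qed.

Lemma cycle_insert a t u p :
  is_cycle e (a :: t) -> path e u p -> uniq (u :: p) ->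
  ~~ has (mem (u :: p)) (a :: t) -> e (last a t) u -> e (last u p) a ->
  is_cycle e (a :: t ++ u :: p).
Proof.
case/and3P=> ut st ct pp up dis e1 e2; apply/and3P; split.
- by rewrite -cat_cons cat_uniq ut up andbT has_sym.
- by rewrite -cat_cons size_cat ltn_addr.
- move: ct; rewrite /= !rcons_path => /andP[pt _].
  by rewrite cat_path pt /= e1 last_cat /= pp e2.
Qed.

(** [crossing] is applied to the list closed by a second copy of [a], so that the closing edge
    counts too; the cycle is then turned so that the edge found joins its last vertex to its
    first. *)
Lemma cycle_gap u w s :
  size s < count (e u) s + count (e w) s ->
  exists i a t, [/\ rot i s = a :: t, e (last a t) u & e w a].
Proof.
case: s => [|a t] // lt.
have [|l [z [z' [r [E ez ez']]]]] := @crossing _ (e u) (e w) a (rcons t a).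
  rewrite size_rcons belast_rcons -cats1 count_cat /=; move: lt => /=; lia.
have [El | [r' Er]] : (r = [::]) \/ (exists r', r = rcons r' a).
- case: (lastP r) E => [|r' x] E; [by left | right; exists r'].
  by move: E; rewrite -!rcons_cons -rcons_cat => /rcons_inj[_ ->].
- move: E; rewrite El -[[:: z; z']]/([:: z] ++ [:: z']) catA cats1 -rcons_cons => /rcons_inj[E1 E2].
  exists 0, a, t; rewrite rot0; split=> //; last by rewrite E2.
  by rewrite -[last a t]/(last a (a :: t)) E1 last_cat /= esym.
exists (size (l ++ [:: z])), z', (r' ++ l ++ [:: z]).
have E1 : a :: t = (l ++ [:: z]) ++ z' :: r'.
  move: E; rewrite Er -rcons_cons -[z :: _]/([:: z] ++ _) catA -rcons_cons -rcons_cat.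
  by move=> /rcons_inj[].
by rewrite E1 rot_size_cat; split=> //; rewrite !last_cat /= esym.
Qed.

End Cycles.

(** * Chords, degrees and Ore's theorem *)

Section Chords.
Variable T : finType.
Variable e : rel T.
Hypothesis esym : symmetric e.
Hypothesis eirr : irreflexive e.

Definition dg (W : {set T}) (v : T) : nat := #|[set w in W | e v w]|.

Lemma dg_set (s : seq T) v : uniq s -> dg [set x in s] v = count (e v) s.
Proof.
move=> us; rewrite -size_filter /dg -(card_uniqP (filter_uniq (e v) us)).
by apply: eq_card => w; rewrite !inE mem_filter andbC.
Qed.

Lemma dgID (A W : {set T}) v : dg W v = dg (W :&: A) v + dg (W :\: A) v.
Proof.
rewrite /dg -(cardsID A [set w in W | e v w]).
by congr (_ + _); apply: eq_card => w; rewrite !inE;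
  case: (w \in W); case: (w \in A); rewrite /= ?andbF ?andbT.
Qed.

Lemma dgU (A B : {set T}) v : [disjoint A & B] -> dg (A :|: B) v = dg A v + dg B v.
Proof.
move=> dis; rewrite (dgID A) setUK setDUl setDv set0U.
by congr (_ + dg _ _); apply/setDidPl; rewrite disjoint_sym.
Qed.

Lemma dg_le (A : {set T}) v : dg A v <= #|A|.
Proof. by apply/subset_leq_card/subsetP => w; rewrite inE => /andP[]. Qed.

Lemma dg_lt (A : {set T}) v : v \in A -> dg A v < #|A|.
Proof.
move=> vA; apply/proper_card/properP; split; last by exists v; rewrite // inE eirr andbF.
by apply/subsetP => w; rewrite inE => /andP[].
Qed.

Lemma dg0 (A : {set T}) v : (forall w, w \in A -> ~~ e v w) -> dg A v = 0.
Proof.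
move=> h; apply/eqP; rewrite cards_eq0; apply/eqP/setP => w; rewrite !inE.
by case: (boolP (w \in A)) => //= /h/negbTE.
Qed.

Lemma dgT v : dg setT v = deg e v.
Proof. by apply: eq_card => w; rewrite !inE. Qed.

Lemma dg_gt0 (A : {set T}) v : 0 < dg A v -> exists2 w, w \in A & e v w.
Proof. by case/card_gt0P=> w; rewrite inE => /andP[wA evw]; exists w. Qed.

Definition del (K : {set {set T}}) : rel T :=
  fun x y => e x y && ([set x; y] \notin K).

Lemma del_sym K : symmetric (del K).
Proof. by move=> x y; rewrite /del esym setUC. Qed.

Lemma del_irr K : irreflexive (del K).
Proof. by move=> x; rewrite /del eirr. Qed.

Lemma del_sub K : subrel (del K) e.
Proof. by move=> x y /andP[]. Qed.

Lemma del_notin K x y : x \notin cover K -> e x y -> del K x y.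
Proof.
move=> xK exy; rewrite /del exy /=; apply: contra xK => h.
by apply/bigcupP; exists [set x; y]; rewrite // !inE eqxx.
Qed.

Lemma is_cycle_sub (e' : rel T) s : subrel e' e -> is_cycle e' s -> is_cycle e s.
Proof. by move=> sub /and3P[us ss cs]; apply/and3P; split; last exact: sub_cycle cs. Qed.

Lemma chordsP s E :
  reflect (exists x y, [/\ x \in s, y \in s, e x y, ~~ cycle_edge s x y & E = [set x; y]])
          (E \in chords e s).
Proof.
rewrite inE; apply: (iffP existsP) => [[x /existsP[y /and5P[? ? ? ? /eqP]]] | [x [y [? ? ? ? ->]]]].
  by exists x, y.
by exists x; apply/existsP; exists y; apply/and5P; split.
Qed.

Lemma cycle_del_chords (K : {set {set T}}) s :
  K \subset chords e s -> is_cycle e s -> is_cycle (del K) s.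
Proof.
move=> /subsetP sub /and3P[us ss cs]; apply/and3P; split=> //.
apply: cycle_from_next => // x xs; rewrite /del (next_cycle cs xs) /=.
apply/negP => /sub/chordsP[x' [y' [_ _ exy nc E]]].
have neq : x' != y' by apply: contraTneq exy => ->; rewrite eirr.
have : x' \in [set x; next s x] by rewrite E !inE eqxx.
have : y' \in [set x; next s x] by rewrite E !inE eqxx orbT.
move: nc; rewrite /cycle_edge !inE negb_or => /andP[n1 n2].
case/orP=> /eqP Ey; case/orP=> /eqP Ex; subst x' y'.
- by rewrite eqxx in neq.
- by rewrite eqxx in n2.
- by rewrite eqxx in n1.
- by rewrite eqxx in neq.
Qed.

(* Re-routing a cycle inside the graph without [K] keeps the edges of [K] chords. *)
Lemma del_cycle_chorded c (K : {set {set T}}) s :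
  is_cycle (del K) s -> c <= #|K| -> cover K \subset [set x in s] ->
  (forall E, E \in K -> exists x y, e x y /\ E = [set x; y]) ->
  c_chorded e c s.
Proof.
move=> cs cK /subsetP sub edge; apply/andP; split; first exact: is_cycle_sub (@del_sub K) cs.
apply: leq_trans cK _; apply/subset_leq_card/subsetP => E EK.
have [x [y [exy eE]]] := edge E EK.
have inS z : z \in E -> z \in s.
  by move=> zE; have := sub z; rewrite inE; apply; apply/bigcupP; exists E.
have [xs ys] : x \in s /\ y \in s by split; apply: inS; rewrite eE !inE eqxx ?orbT.
case/and3P: cs => us ss cs.
apply/chordsP; exists x, y; split=> //; rewrite /cycle_edge negb_or.
apply/andP; split; apply/negP => /eqP h.
- by have := next_cycle cs xs; rewrite /del -h -eE EK andbF.
- by have := next_cycle cs ys; rewrite /del -h setUC -eE EK andbF.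
Qed.

(** Of the edges from [v] to vertices of the cycle, all but those to [next s v] and [prev s v] are
    chords. *)
Lemma deg_chorded c s v :
  is_cycle e s -> v \in s -> c + 2 <= count (e v) s -> c_chorded e c s.
Proof.
move=> cs vs le; apply/andP; split=> //; case/and3P: cs => us ss cs.
pose D := [set w in s | e v w] :\ next s v :\ prev s v.
have cD : c <= #|D|.
  have E : #|[set w in s | e v w]| = count (e v) s.
    by rewrite -dg_set //; apply: eq_card => w; rewrite !inE.
  have := cardsD1 (next s v) [set w in s | e v w].
  have := cardsD1 (prev s v) ([set w in s | e v w] :\ next s v).
  by rewrite -/D E; lia.
apply: leq_trans cD _.
have inj : {in D &, injective (fun w => [set v; w])}.
  move=> w1 w2; rewrite !inE => /and4P[_ _ _ ev1] _ E.
  have : w1 \in [set v; w2] by rewrite -E !inE eqxx orbT.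
  rewrite !inE => /orP[/eqP h|/eqP //]; by rewrite h eirr in ev1.
rewrite -(card_in_imset inj); apply/subset_leq_card/subsetP => E /imsetP[w].
move=> wD ->; have {wD} [np nn ws evw] : [/\ w != prev s v, w != next s v, w \in s & e v w].
  by apply/and4P; move: wD; rewrite !inE.
apply/chordsP; exists v, w; split=> //; rewrite /cycle_edge negb_or nn /=.
apply: contra np => /eqP ->; by rewrite prev_next.
Qed.

Lemma c_chorded_rot c i s : c_chorded e c (rot i s) -> c_chorded e c s.
Proof.
move=> /andP[cy le]; rewrite is_cycle_rot in cy; apply/andP; split=> //.
have us : uniq s by case/and3P: cy.
apply: leq_trans le _; apply/subset_leq_card/subsetP => E /chordsP[x [y [xs ys exy nc ->]]].
rewrite !mem_rot in xs ys; apply/chordsP; exists x, y; split=> //.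
by move: nc; rewrite /cycle_edge !next_rot.
Qed.

(** The insertion can be done in the graph without the old chords, since these have all their ends
    on the old cycle; hence they remain chords. *)
Lemma c_chorded_insert c a t u p :
  c_chorded e c (a :: t) -> path e u p -> uniq (u :: p) ->
  ~~ has (mem (u :: p)) (a :: t) -> e (last a t) u -> e (last u p) a ->
  c_chorded e c (a :: t ++ u :: p).
Proof.
move=> /andP[cy le] pp up dis e1 e2.
set K := chords e (a :: t).
have cK : cover K \subset [set x in a :: t].
  apply/subsetP => z /bigcupP[E /chordsP[x [y [xs ys _ _ ->]]]].
  by rewrite in_set2 inE => /orP[] /eqP ->.
have out z : z \in u :: p -> z \notin cover K.
  move=> zp; apply: contra dis => /(subsetP cK); rewrite inE => zs.
  by apply/hasP; exists z.
apply: (@del_cycle_chorded c K) => //.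
- apply: cycle_insert => //.
  + exact: cycle_del_chords.
  + have sub : all (fun z => z \notin cover K) (u :: p) by apply/allP.
    move: sub pp; elim: p u {up dis e1 e2 out} => //= w p IH u /and3P[ou ow op] /andP[euw pp].
    by rewrite del_notin //= IH //= ow.
  + by rewrite del_sym del_notin ?out ?mem_head // esym.
  + by rewrite del_notin // out // mem_last.
- apply: subset_trans cK _; apply/subsetP => z; rewrite !inE => /orP[-> //|zt].
  by rewrite mem_cat zt orbT.
- by move=> E /chordsP[x [y [_ _ exy _ ->]]]; exists x, y.
Qed.

(** Ore's theorem for the subgraph induced by [D]. A longest path closes to a cycle on its vertices;
    opened anywhere, this is again a longest path, so no edge leaves it, and the degree condition
    forces it to span [D]. *)
Lemma ore (D : {set T}) :
  2 < #|D| ->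
  (forall u w, u \in D -> w \in D -> u != w -> ~~ e u w -> #|D| <= dg D u + dg D w) ->
  exists s, is_cycle e s /\ s =i D.
Proof.
move=> D3 hD.
pose P m := exists a t, [/\ path e a t, uniq (a :: t), {subset a :: t <= D} & size t = m].
have [a0 a0D] : exists a0, a0 \in D by apply/card_gt0P; lia.
have P0 : P 0 by exists a0, [::]; split=> //= z; rewrite inE => /eqP ->.
have bP m : P m -> m <= #|D|.
  move=> [a [t [_ u sub <-]]]; have := uniq_leq_size u (s2 := enum D).
  by rewrite -cardE /= => h; apply/ltnW/h => z /sub; rewrite mem_enum.
have [m [[a [t [pt ut sub st]]] maxm]] := ex_max_nat P0 bP.
have ext a' t' z : path e a' t' -> perm_eq (a' :: t') (a :: t) -> z \in D -> z \notin a :: t ->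
    ~~ e a' z.
  move=> pt' pq zD zn; apply/negP => eaz.
  have : P m.+1.
    exists z, (a' :: t'); split=> /=.
    - by rewrite esym eaz.
    - by rewrite (perm_mem pq) zn -/(uniq (a' :: t')) (perm_uniq pq).
    - by move=> y; rewrite inE => /orP[/eqP->//|]; rewrite (perm_mem pq); apply: sub.
    - by have := perm_size pq => /= -[->]; rewrite st.
  by move/maxm; rewrite ltnn.
have lastP' : path e (last a t) (rev (belast a t)) /\ perm_eq (last a t :: rev (belast a t)) (a :: t).
  split; first by rewrite rev_path_sym.
  by rewrite [a :: t]lastI perm_sym perm_rcons perm_cons perm_sym perm_rev.
have stD : size (a :: t) = #|[set x in a :: t]| by rewrite cardsE (card_uniqP ut).
have endD (x : T) : (forall z, z \in D -> z \notin a :: t -> ~~ e x z) -> dg D x = count (e x) (a :: t).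
  move=> h; rewrite (dgID [set x in a :: t]) (dg0 (A := D :\: _)) ?addn0; last first.
    by move=> z; rewrite !inE => /andP[zn zD]; apply: h => //; rewrite inE.
  rewrite -dg_set //; congr dg; apply/setIidPr; apply/subsetP => z; rewrite inE; exact: sub.
have dga := endD a (fun z => @ext a t z pt (perm_refl _)).
have dgl := endD (last a t) (fun z => @ext _ _ z lastP'.1 lastP'.2).
have cyc : 1 < size t -> exists s, perm_eq s (a :: t) /\ is_cycle e s.
  move=> t2; case: (boolP (e a (last a t))) => [eal | nal].
    exists (a :: t); split=> //; apply/and3P; split=> //=.
    by rewrite rcons_path pt /= esym.
  apply: path_close => //; rewrite -dga -dgl.
  have : #|D| <= dg D a + dg D (last a t).
    apply: hD => //; [exact/sub/mem_head | exact/sub/mem_last |].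
    apply/eqP => E; case/andP: ut => + _; rewrite {1}E; case: (t) t2 => //= b t' _.
    by rewrite mem_last.
  apply: leq_trans; move: stD => /= ->; apply/subset_leq_card/subsetP => z; rewrite inE; exact: sub.
(* With at least three vertices the path closes to a cycle, which can be opened at any [x]; with at
   most two, every vertex is an end. *)
have sep x z : x \in a :: t -> z \in D -> z \notin a :: t -> ~~ e x z.
  move=> xt zD zn; case: (ltnP 1 (size t)) => [t2 | t1].
    have [s [ps /and3P[us ss cs]]] := cyc t2.
    have xs : x \in s by rewrite (perm_mem ps).
    have [i s' Es] := rot_to xs.
    apply: (ext x s') => //.
      have : cycle e (rot i s) by rewrite rot_cycle.
      by rewrite Es /= rcons_path => /andP[].
    by rewrite -Es perm_rot.
  move: xt; case: t t1 lastP' pt ext {dga dgl cyc endD stD ut sub st zn} (zn) => [|b [|? ?]] //= _ [pl pq] pt ext zn.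
    rewrite inE => /eqP ->; exact: (ext a [::]).
  rewrite !inE => /orP[] /eqP ->; first exact: (ext a [:: b]).
  exact: (ext b [:: a] z pl pq).
(* Within [D], [a] has neighbours only on the path and [z] only off it, so their degree sum is below
   [#|D|]. *)
have allD z : z \in D -> z \in a :: t.
  move=> zD; apply/negPn/negP => zn.
  have aD := sub _ (mem_head a t).
  have naz : a != z by apply: contraNneq zn => <-; apply: mem_head.
  have := hD a z aD zD naz (sep _ _ (mem_head a t) zD zn).
  have l1 : dg D a < #|[set x in a :: t]|.
    by rewrite dga -dg_set //; apply: dg_lt; rewrite inE mem_head.
  have l2 : dg D z <= #|D :\: [set x in a :: t]|.
    apply/subset_leq_card/subsetP => y; rewrite !inE => /andP[yD ezy]; rewrite yD andbT.
    by apply/negP => yt; have := sep y z; rewrite inE esym ezy => /(_ yt zD zn).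
  have := cardsID [set x in a :: t] D.
  have -> : D :&: [set x in a :: t] = [set x in a :: t].
    by apply/setIidPr; apply/subsetP => y; rewrite inE; apply: sub.
  by lia.
have [|s [ps cs]] := cyc.
  have : #|D| <= #|[set x in a :: t]| by apply/subset_leq_card/subsetP => z /allD; rewrite inE.
  by rewrite -stD /=; lia.
exists s; split=> // z; rewrite (perm_mem ps); apply/idP/idP; [exact: sub | exact: allD].
Qed.

End Chords.

(** * Packings of chorded cycles *)

Section Packings.
Variable T : finType.
Variable e : rel T.
Hypothesis esym : symmetric e.
Hypothesis eirr : irreflexive e.
Variable c : nat.

Definition packing (P : seq (seq T)) (W : {set T}) : Prop :=
  [/\ all (c_chorded e c) P, uniq (flatten P) & [set x in flatten P] = W].

Definition packable (m : nat) (W : {set T}) : Prop :=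
  exists P, size P = m /\ packing P W.

Lemma c_chorded_uniq s : c_chorded e c s -> uniq s.
Proof. by case/andP=> /and3P[]. Qed.

Lemma packing_perm P P' (W : {set T}) : perm_eq P P' -> packing P W -> packing P' W.
Proof.
move=> pP [h1 h2 h3]; split.
- by rewrite -(perm_all _ pP).
- by rewrite -(perm_uniq (perm_flatten pP)).
- by rewrite -h3; apply/setP => x; rewrite !inE (perm_mem (perm_flatten pP)).
Qed.

Lemma packing_cons s P (W : {set T}) :
  c_chorded e c s -> [disjoint [set x in s] & W] -> packing P W ->
  packing (s :: P) ([set x in s] :|: W).
Proof.
move=> cs dis [h1 h2 h3]; split=> /=; first by rewrite cs.
- rewrite cat_uniq (c_chorded_uniq cs) h2 andbT /=.
  apply/hasPn => x xP; apply/negP => /= xs.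
  by move/disjoint_setI0/setP: dis => /(_ x); rewrite -h3 !inE xs xP.
- by rewrite -h3; apply/setP => x; rewrite !inE mem_cat.
Qed.

Lemma packing_uncons s P (W : {set T}) : packing (s :: P) W ->
  [/\ c_chorded e c s, [set x in s] \subset W & packing P (W :\: [set x in s])].
Proof.
case=> /= /andP[h1 h2]; rewrite cat_uniq => /and3P[us /hasPn dis uP] <-; split=> //.
  by apply/subsetP => x; rewrite !inE mem_cat => ->.
split=> //; apply/setP => x; rewrite !inE mem_cat.
case: (boolP (x \in s)) => //= xs; apply/negP => xP.
by have := dis x xP; rewrite /= xs.
Qed.

Lemma packing_pick P (W : {set T}) s : packing P W -> s \in P ->
  exists P', size P = (size P').+1 /\ packing (s :: P') W.
Proof.
move=> pP sP; exists (rem s P); split; last exact: packing_perm (perm_to_rem sP) pP.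
by rewrite (perm_size (perm_to_rem sP)).
Qed.

Lemma packing_find P (W : {set T}) x : packing P W -> x \in W -> exists2 s, s \in P & x \in s.
Proof. by case=> _ _ <-; rewrite inE => /flattenP. Qed.

Lemma packable0 : packable 0 set0.
Proof. by exists [::]; split=> //; split=> //; apply/setP => x; rewrite !inE. Qed.

Lemma packable_cons s m (W : {set T}) :
  c_chorded e c s -> [disjoint [set x in s] & W] -> packable m W ->
  packable m.+1 ([set x in s] :|: W).
Proof.
move=> cs dis [P [sP pP]]; exists (s :: P); split; first by rewrite /= sP.
exact: packing_cons.
Qed.

Lemma packableU m1 m2 (W1 W2 : {set T}) : [disjoint W1 & W2] ->
  packable m1 W1 -> packable m2 W2 -> packable (m1 + m2) (W1 :|: W2).
Proof.
move=> dis [P1 [<- [a1 u1 e1]]] [P2 [<- [a2 u2 e2]]]; exists (P1 ++ P2); split.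
  by rewrite size_cat.
split; first by rewrite all_cat a1.
- rewrite flatten_cat cat_uniq u1 u2 andbT; apply/hasPn => x x2; apply/negP => /= x1.
  by move/disjoint_setI0/setP: dis => /(_ x); rewrite -e1 -e2 !inE x1 x2.
- by rewrite -e1 -e2 flatten_cat; apply/setP => x; rewrite !inE mem_cat.
Qed.

(** Summing over the cycles, some cycle receives more edges from the two ends than it has vertices,
    and [cycle_gap] yields an edge of it to be replaced by the path. *)
Lemma packable_insert m (W : {set T}) u p :
  packable m W -> path e u p -> uniq (u :: p) ->
  [disjoint W & [set x in u :: p]] -> #|W| < dg e W u + dg e W (last u p) ->
  packable m (W :|: [set x in u :: p]).
Proof.
move=> [P [sP pP]] pp up; elim: P m W sP pP => [|s P IH] m W sP pP dis.
  have W0 : #|W| = 0 by case: pP => _ _ <-; apply: eq_card0 => z; rewrite inE.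
  by have := dg_le e W u; have := dg_le e W (last u p); lia.
have [cs sW pP'] := packing_uncons pP.
have us := c_chorded_uniq cs.
have WI : W :&: [set x in s] = [set x in s] by apply/setIidPr.
have dW z : dg e W z = count (e z) s + dg e (W :\: [set x in s]) z.
  by rewrite (dgID e [set x in s]) WI dg_set.
have cW := cardsID [set x in s] W; rewrite WI cardsE (card_uniqP us) in cW.
rewrite !dW => lt; have dis1 : [disjoint [set x in s] & [set x in u :: p]] := disjointWl sW dis.
case: (ltnP (size s) (count (e u) s + count (e (last u p)) s)) => [gap | nogap].
  have [i [a [t [Es e1 e2]]]] := cycle_gap esym gap.
  have [ps pP2] : s =i a :: t /\ c_chorded e c (a :: t).
    split; first by move=> z; rewrite -Es mem_rot.
    by rewrite -Es; move: cs; rewrite -{1}[s](rotK i) => /c_chorded_rot.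
  have new : c_chorded e c (a :: t ++ u :: p).
    apply: c_chorded_insert => //; apply/hasPn => z; rewrite -ps => zs; apply/negP => /= zp.
    by move/disjoint_setI0/setP: dis1 => /(_ z); rewrite in_setI !in_set zs zp.
  have -> : W :|: [set x in u :: p] = [set x in a :: t ++ u :: p] :|: (W :\: [set x in s]).
    apply/setP => z; rewrite !in_setU in_setD !in_set -cat_cons mem_cat -ps.
    have := subsetP sW z; rewrite inE; case: (z \in s) => /= [->//|_].
    by rewrite orbC.
  rewrite -sP; apply: packable_cons => //; last by exists P.
  apply/pred0P => z /=; rewrite in_setD !in_set -cat_cons mem_cat -ps.
  case: (boolP (z \in s)) => //= _.
  by apply/negP => /andP[zp zW]; move/disjoint_setI0/setP: dis => /(_ z); rewrite in_setI zW !in_set zp.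
have [||Q [sQ pQ]] := IH (size P) (W :\: [set x in s]) erefl pP'.
- by apply: disjointWl dis; apply: subsetDl.
- by lia.
exists (s :: Q); split; first by rewrite /= sQ.
have -> : W :|: [set x in u :: p] = [set x in s] :|: ((W :\: [set x in s]) :|: [set x in u :: p]).
  by rewrite setUA; congr (_ :|: _); rewrite -[in LHS](setID W [set x in s]) WI.
apply: packing_cons => //.
rewrite -setI_eq0 setIUr setU_eq0; apply/andP; split; last by rewrite setI_eq0.
by apply/eqP/setP => z; rewrite !inE; case: (z \in s).
Qed.

(** * Dense vertex sets: splitting off small cycles and absorbing a path *)

Lemma greedy_path (M : {set T}) m v :
  v \in M -> (forall z, z \in M -> m <= dg e M z) ->
  exists a t, [/\ path e a t, uniq (a :: t), {subset a :: t <= M} & size t = m].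
Proof.
move=> vM dM.
have step j : j <= m ->
    exists a t, [/\ path e a t, uniq (a :: t), {subset a :: t <= M} & size t = j].
  elim: j => [_|j IH lt]; first by exists v, [::]; split=> // z; rewrite inE => /eqP->.
  have [a [t [pt ut sub st]]] := IH (ltnW lt).
  have aM := sub _ (mem_head a t).
  (* At most [size t = j < m] neighbours of the front vertex [a] are used up, so the path grows at
     its front. *)
  have : 0 < dg e (M :\: [set x in t]) a.
    have := dgID e [set x in t] M a; have := dM a aM.
    have : dg e (M :&: [set x in t]) a <= size t.
      apply: leq_trans (dg_le _ _ _) _; apply: leq_trans (subset_leq_card (subsetIr _ _)) _.
      by rewrite cardsE; apply: card_size.
    by lia.
  case/dg_gt0=> z; rewrite !inE => /andP[zt zM] eaz.
  exists z, (a :: t); split=> /=.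
  - by rewrite esym eaz.
  - rewrite inE negb_or zt andbT; apply/andP; split=> //.
    by apply: contraTneq eaz => ->; rewrite eirr.
  - by move=> y; rewrite inE => /orP[/eqP->|/sub].
  - by rewrite st.
exact: step.
Qed.

(** Every vertex misses at most [d] others; in this form the bound passes to subsets with the same
    [d]. *)
Definition dense (R : {set T}) (d : nat) : Prop :=
  forall v, v \in R -> #|R| <= dg e R v + d + 1.

Lemma dense_sub (R S : {set T}) d : S \subset R -> dense R d -> dense S d.
Proof.
move=> sub dR v vS; have := dR v (subsetP sub v vS).
have := dgID e S R v; have := dg_le e (R :\: S) v.
by have := cardsID S R; rewrite (setIidPr sub); lia.
Qed.

(* A fan: a vertex joined to all vertices of a path; its spokes are the chords. *)
Lemma dense_fan (R : {set T}) d :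
  dense R d -> 2 * d + c + 3 <= #|R| ->
  exists s, [/\ c_chorded e c s, size s = c + 3 & [set x in s] \subset R].
Proof.
move=> dR large.
have [u uR] : exists u, u \in R by apply/card_gt0P; lia.
pose M := [set w in R | e u w].
have sMR : M \subset R by apply/subsetP => z; rewrite inE => /andP[].
have cM : #|R| <= #|M| + d + 1 by apply: dR.
have [v vM] : exists v, v \in M by apply/card_gt0P; lia.
(* The path has [c + 2] vertices: two of the spokes become cycle edges and [c] are left as
   chords. *)
have [|a [t [pt ut sub st]]] := @greedy_path M (c + 1) v vM.
  by move=> z zM; have := dense_sub sMR dR zM; lia.
have eu z : z \in a :: t -> e u z by move=> /sub; rewrite inE => /andP[].
have un : u \notin a :: t by apply/negP => /eu; rewrite eirr.
have cy : is_cycle e (u :: a :: t).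
  apply/and3P; split; first by rewrite cons_uniq un.
    by rewrite /= st; lia.
  by rewrite /= rcons_path pt (eu a) ?mem_head //= esym eu // mem_last.
exists (u :: a :: t); split.
- apply: (deg_chorded eirr cy (mem_head _ _)).
  have -> : count (e u) (u :: a :: t) = size (a :: t).
    by rewrite /= eirr /= -[_ + _]/(count (e u) (a :: t)); apply/eqP; rewrite -all_count; apply/allP.
  by rewrite /= st; lia.
- by rewrite /= st; lia.
- apply/subsetP => z; rewrite inE [_ \in _]inE => /orP[/eqP-> //|/sub].
  exact: (subsetP sMR).
Qed.

(** After [r] fans are split off, the rest of [R] is still dense and spanned by a cycle by Ore's
    theorem. Both ends of the path miss at most [d] vertices of it, so the path can be inserted. *)
Lemma dense_absorb r (R : {set T}) d u p :
  dense R d -> path e u p -> uniq (u :: p) -> [disjoint R & [set x in u :: p]] ->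
  #|R| <= dg e R u + d -> #|R| <= dg e R (last u p) + d ->
  2 * d + c + 3 + r * (c + 3) <= #|R| ->
  packable r.+1 (R :|: [set x in u :: p]).
Proof.
move=> + pp up; elim: r R => [|r IH] R dR dis du dl large.
  have [|w1 w2 w1R w2R neq nadj|s [cs Es]] := @ore _ e esym eirr R; first by lia.
    by have := dR _ w1R; have := dR _ w2R; lia.
  have us : uniq s by case/and3P: cs.
  have RE : [set x in s] = R by apply/setP => x; rewrite inE Es.
  have sz : size s = #|R| by rewrite -RE cardsE (card_uniqP us).
  have cntu : count (e u) s = dg e R u by rewrite -RE dg_set.
  have cntl : count (e (last u p)) s = dg e R (last u p) by rewrite -RE dg_set.
  have [|i [a [t [Est e1 e2]]]] := @cycle_gap _ e esym u (last u p) s; first by lia.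
  have mem_at z : (z \in a :: t) = (z \in R) by rewrite -Est mem_rot Es.
  have cy : is_cycle e (a :: t ++ u :: p).
    apply: cycle_insert => //; first by rewrite -Est is_cycle_rot.
    apply/hasPn => z; rewrite mem_at => zR; apply/negP => /= zp.
    by move/disjoint_setI0/setP: dis => /(_ z); rewrite in_setI !in_set zR zp.
  have cc : c_chorded e c (a :: t ++ u :: p).
    apply: (deg_chorded eirr cy (v := u)).
      by rewrite -cat_cons mem_cat mem_head orbT.
    rewrite -cat_cons count_cat -Est.
    have -> : count (e u) (rot i s) = count (e u) s by apply/permP; rewrite perm_rot.
    by lia.
  have -> : R :|: [set x in u :: p] = [set x in a :: t ++ u :: p] :|: set0.
    by rewrite setU0; apply/setP => z; rewrite in_setU !in_set -cat_cons mem_cat mem_at.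
  apply: packable_cons => //; last exact: packable0.
  by rewrite -setI_eq0 setI0.
have [|s [cs ss sR]] := dense_fan dR; first by lia.
have us := c_chorded_uniq cs.
have cR := cardsID [set x in s] R.
rewrite (setIidPr sR) cardsE (card_uniqP us) ss in cR.
have dgR z : dg e R z <= c + 3 + dg e (R :\: [set x in s]) z.
  rewrite (dgID e [set x in s]) leq_add2r (setIidPr sR).
  by apply: leq_trans (dg_le _ _ _) _; rewrite cardsE (card_uniqP us) ss.
have dR' : dense (R :\: [set x in s]) d by apply: dense_sub dR; apply: subsetDl.
have bound z : #|R| <= dg e R z + d -> #|R :\: [set x in s]| <= dg e (R :\: [set x in s]) z + d.
  by have := dgR z; lia.
have dis' := disjointWl (subsetDl R [set x in s]) dis.
have := IH _ dR' dis' (bound _ du) (bound _ dl).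
have -> : R :|: [set x in u :: p] = [set x in s] :|: ((R :\: [set x in s]) :|: [set x in u :: p]).
  by rewrite setUA; congr (_ :|: _); rewrite -[in LHS](setID R [set x in s]) (setIidPr sR).
move=> H; apply: packable_cons => //; last by apply: H; rewrite mulSn in large; lia.
rewrite -setI_eq0 setIUr setU_eq0; apply/andP; split.
  by apply/eqP/setP => z; rewrite !inE; case: (z \in s).
by rewrite setI_eq0; apply: disjointWl sR dis.
Qed.

End Packings.

(** * Absorbing one of two runs of vertices *)

Section Absorption.
Variable T : finType.
Variable e : rel T.
Hypothesis esym : symmetric e.

Lemma dgU_seq (W : {set T}) s v : uniq s -> [disjoint W & [set x in s]] ->
  dg e (W :|: [set x in s]) v = dg e W v + count (e v) s.
Proof. by move=> us dis; rewrite dgU // dg_set. Qed.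

Lemma cardU_seq (W : {set T}) s : uniq s -> [disjoint W & [set x in s]] ->
  #|W :|: [set x in s]| = #|W| + size s.
Proof.
by move=> us dis; rewrite cardsU (disjoint_setI0 dis) cards0 subn0 cardsE (card_uniqP us).
Qed.

(* Let [i0] be the first index for which [Q (W i0.+1 0)] fails. Then [Q (W i j)] holds for all
   [i <= i0] and all [j]: the vertex [nth p2 j] has no neighbour among the first [i0] vertices
   of [p1], so if more than half of [W i0 j] is adjacent to it, then also more than half of
   [W i j]. *)
Lemma absorption (Q : {set T} -> Prop) (W0 : {set T}) (p1 p2 : seq T) (x0 : T)
    (W := fun i j => W0 :|: [set x in take i p1 ++ take j p2]) :
  uniq (p1 ++ p2) -> [disjoint W0 & [set x in p1 ++ p2]] -> Q W0 ->
  (forall A v, Q A -> v \notin A -> #|A| < dg e A v + dg e A v -> Q (v |: A)) ->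
  (forall i j, i < size p1 -> j < size p2 -> Q (W i j) -> ~~ e (nth x0 p1 i) (nth x0 p2 j)) ->
  (forall i j, i < size p1 -> j < size p2 -> Q (W i j) ->
     #|W i j| + 2 <= dg e (W i j) (nth x0 p1 i) + dg e (W i j) (nth x0 p2 j)) ->
  ~ Q (W0 :|: [set x in p1]) -> ~ Q (W0 :|: [set x in p2]) -> False.
Proof.
move=> up dis QW0 ins F1 F2 F3 F4.
have sub_take i j x : x \in take i p1 ++ take j p2 -> x \in p1 ++ p2.
  by rewrite !mem_cat => /orP[] /mem_take ->; rewrite ?orbT.
have ut i j : uniq (take i p1 ++ take j p2).
  move: up; rewrite !cat_uniq => /and3P[u1 d u2]; rewrite !take_uniq //= andbT.
  by apply: contra d => /hasP[x /mem_take x2 /mem_take x1]; apply/hasP; exists x.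
have dt i j : [disjoint W0 & [set x in take i p1 ++ take j p2]].
  by apply: disjointWr dis; apply/subsetP => x; rewrite !in_set; apply: sub_take.
have dgW i j v : dg e (W i j) v =
    dg e W0 v + (count (e v) (take i p1) + count (e v) (take j p2)).
  by rewrite dgU_seq // count_cat.
have cW i j : i <= size p1 -> j <= size p2 -> #|W i j| = #|W0| + (i + j).
  by move=> hi hj; rewrite cardU_seq // size_cat !size_takel.
have notW i j x : x \in drop i p1 ++ drop j p2 -> x \notin W i j.
  move=> xd; have xp : x \in p1 ++ p2.
    by move: xd; rewrite !mem_cat => /orP[] /mem_drop ->; rewrite ?orbT.
  rewrite in_setU in_set negb_or; apply/andP; split.
    by apply/negP => xW; move/disjoint_setI0/setP: dis => /(_ x); rewrite in_setI xW in_set xp in_set0.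
  have : perm_eq (p1 ++ p2) ((take i p1 ++ take j p2) ++ (drop i p1 ++ drop j p2)).
    rewrite -{1}(cat_take_drop i p1) -{1}(cat_take_drop j p2).
    by apply/permP => a; rewrite !count_cat; lia.
  move/perm_uniq => E; move: up; rewrite E cat_uniq => /and3P[_ /hasPn d _].
  exact: d.
have W1S i j : i < size p1 -> W i.+1 j = nth x0 p1 i |: W i j.
  move=> hi; apply/setP => x; rewrite /W (take_nth x0) // !in_setU !in_set !mem_cat mem_rcons in_cons in_set1.
  by case: (x == _); rewrite /= ?orbT.
have W2S i j : j < size p2 -> W i j.+1 = nth x0 p2 j |: W i j.
  move=> hj; apply/setP => x; rewrite /W (take_nth x0 hj) !in_setU !in_set !mem_cat mem_rcons in_cons in_set1.
  by case: (x == _); rewrite /= ?orbT.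
have W00 : W 0 0 = W0 by apply/setP => x; rewrite /W !take0 !inE orbF.
have [i0 [lis Qis nQ]] : exists i0, [/\ i0 < size p1, forall i, i <= i0 -> Q (W i 0) & ~ Q (W i0.+1 0)].
  have /(_ _ (leqnn _)) : forall m, m <= size p1 -> (forall i, i <= m -> Q (W i 0)) \/
    exists i0, [/\ i0 < size p1, forall i, i <= i0 -> Q (W i 0) & ~ Q (W i0.+1 0)].
    elim=> [|m IH] lm.
      by left=> i; rewrite leqn0 => /eqP->; rewrite W00.
    have [all|ex] := IH (ltnW lm); last by right.
    case: (classic (Q (W m.+1 0))) => q; last by right; exists m.
    by left=> i; rewrite leq_eqVlt => /orP[/eqP->//|]; apply: all.
  case=> // all; case: F3; have := all _ (leqnn _).
  by rewrite /W take_size take0 cats0.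
have key j : j <= size p2 -> forall i j', i <= i0 -> j' <= j -> Q (W i j').
  elim: j => [|j IH] lj i j' hi; first by rewrite leqn0 => /eqP->; apply: Qis.
  rewrite leq_eqVlt => /orP[/eqP->|hj']; last by apply: IH => //; apply: ltnW.
  have {}IH := IH (ltnW lj).
  set s1 := nth x0 p1 i0; set s2 := nth x0 p2 j.
  have no1 : count (e s1) (take j p2) = 0.
    apply/eqP; rewrite -leqn0 leqNgt -has_count; apply/hasPn => x /(nthP x0)[j1].
    rewrite size_takel ?(ltnW lj) // => lj1; rewrite nth_take // => <-.
    by apply: F1 => //; [exact: ltn_trans lj1 lj | apply: IH => //; exact: ltnW].
  have no2 : count (e s2) (take i0 p1) = 0.
    apply/eqP; rewrite -leqn0 leqNgt -has_count; apply/hasPn => x /(nthP x0)[i1].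
    rewrite size_takel ?(ltnW lis) // => li1; rewrite nth_take // => <-.
    rewrite esym; apply: F1 => //; [exact: ltn_trans li1 lis | apply: IH => //; exact: ltnW].
  (* [s1] cannot be absorbed by [W i0 0], so it sees at most half of it, and nothing of [take j p2].
     Nearly all of the degree sum in [F2] that remains is due to [s2], which therefore sees more
     than half of every [W i j] with [i <= i0]. *)
  have half : dg e (W i0 0) s1 + dg e (W i0 0) s1 <= #|W i0 0|.
    rewrite leqNgt; apply/negP => lt; apply: nQ; rewrite W1S //; apply: ins lt.
      exact: Qis.
    by apply: notW; rewrite (drop_nth x0) // mem_head.
  have := F2 i0 j lis lj (IH _ _ (leqnn _) (leqnn _)).
  rewrite W2S // => f2; apply: ins; first exact: IH.
    by apply: notW; rewrite mem_cat (drop_nth x0 lj) mem_head orbT.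
  move: half f2; rewrite !dgW !cW ?(ltnW lis) ?(ltnW lj) // ?(leq_trans hi (ltnW lis)) // take0 /= -/s1 -/s2.
  rewrite no1 no2; lia.
apply: F4; have := key _ (leqnn _) 0 _ (leq0n _) (leqnn _).
by rewrite /W take_size take0.
Qed.

End Absorption.

(** * Maximum packings *)

Section Maximal.
Variable T : finType.
Variable e : rel T.
Hypothesis esym : symmetric e.
Hypothesis eirr : irreflexive e.
Variables (c k : nat) (L : {set T}).
Hypothesis packL : packable e c k.+1 L.
Hypothesis maxL : forall W, packable e c k.+1 W -> #|W| <= #|L|.
Hypothesis sigma : sigma2_ge e #|T|.
Hypothesis c_gt0 : 0 < c.

Local Notation H := (~: L).

Definition att (x : T) : bool := [exists h, (h \in H) && e x h].

(** Only the vertex set of the other cycles is recorded, so that they may be repacked freely. *)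
Definition member (C : seq T) : Prop :=
  [/\ c_chorded e c C, [set x in C] \subset L & packable e c k (L :\: [set x in C])].

Lemma member_of_packing P C : packing e c P L -> size P = k.+1 -> C \in P -> member C.
Proof.
move=> pP sP CP; have [P' [sP' pP']] := packing_pick pP CP.
have [cC sub pQ] := packing_uncons pP'; split=> //; exists P'.
by split=> //; move: sP; rewrite sP' => -[].
Qed.

Lemma member_rot i C : member C -> member (rot i C).
Proof.
case=> cC sub pC.
have E : [set x in rot i C] = [set x in C] by apply/setP => z; rewrite !inE mem_rot.
split; rewrite ?E //; by move: cC; rewrite -{1}[C](rotK i) => /c_chorded_rot.
Qed.

Lemma member_uniq C : member C -> uniq C.
Proof. by case=> /c_chorded_uniq. Qed.

Lemma member_size C : member C -> 2 < size C.
Proof. by case=> /andP[/and3P[]]. Qed.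

Lemma cardH : #|L| + #|H| = #|T|. Proof. exact: cardsC. Qed.

Lemma degE v : deg e v = dg e L v + dg e H v.
Proof. by rewrite -dgT (dgID e L) setTI setTD. Qed.

Lemma no_insert u p : path e u p -> uniq (u :: p) -> {subset u :: p <= H} ->
  dg e L u + dg e L (last u p) <= #|L|.
Proof.
move=> pp up sub; rewrite leqNgt; apply/negP => lt.
have dis : [disjoint L & [set x in u :: p]].
  apply/pred0P => z; rewrite /= inE; apply/negP => /andP[zL /sub].
  by rewrite inE zL.
have /maxL := packable_insert esym eirr packL pp up dis lt.
rewrite cardsU (disjoint_setI0 dis) cards0 subn0 cardsE (card_uniqP up) /=; lia.
Qed.

Lemma dgL_half u : u \in H -> dg e L u + dg e L u <= #|L|.
Proof. by move=> uH; apply: (@no_insert u [::]) => // z; rewrite inE => /eqP->. Qed.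

(** Each vertex sees at most half of [L] ([dgL_half]), so at least [#|H|] of the degree sum is left
    for [H]. *)
Lemma H_ore u w : u \in H -> w \in H -> u != w -> ~~ e u w -> #|H| <= dg e H u + dg e H w.
Proof.
move=> uH wH neq nadj; have := sigma neq nadj; rewrite !degE -cardH.
by have := dgL_half uH; have := dgL_half wH; lia.
Qed.

(** Non-adjacent vertices have a common neighbour: their neighbourhoods in [H] both avoid [u], and
    by [H_ore] their sizes sum to at least [#|H|]. *)
Lemma H_path u w : u \in H -> w \in H ->
  exists p, [/\ path e u p, last u p = w, uniq (u :: p), {subset u :: p <= H} & size p <= 2].
Proof.
move=> uH wH; case: (eqVneq u w) => [<-|neq].
  by exists [::]; split=> // z; rewrite inE => /eqP->.
case: (boolP (e u w)) => [euw|nadj].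
  exists [:: w]; split=> //=; rewrite ?euw ?inE ?neq // => z.
  by rewrite !inE => /orP[/eqP->|/eqP->]; rewrite -in_setC.
have := H_ore uH wH neq nadj.
pose A := [set z in H | e u z]; pose B := [set z in H | e w z] => le.
have : 0 < #|A :&: B|.
  have : #|A :|: B| <= #|H :\ u|.
    apply/subset_leq_card/subsetP => z; rewrite in_setU in_setD1 !inE.
    case/orP=> /andP[zH ez]; rewrite zH andbT; first by apply: contraTneq ez => ->; rewrite eirr.
    by apply: contraTneq ez => ->; rewrite esym.
  have := cardsD1 u H; rewrite uH; have := cardsUI A B; rewrite /dg -/A -/B in le; lia.
case/card_gt0P=> z; rewrite !inE => /andP[/andP[zH euz] /andP[_ ewz]].
exists [:: z; w]; split=> //=.
- by rewrite euz esym ewz.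
- rewrite !inE negb_or neq !andbT.
  apply/andP; split; [apply: contraTneq euz | apply: contraTneq ewz] => ->; by rewrite eirr.
- by move=> y; rewrite !inE => /or3P[] /eqP-> //; rewrite -in_setC.
Qed.

Lemma att_path x y : att x -> att y ->
  exists u p, [/\ path e u p, e x u, e (last u p) y & uniq (u :: p)]
    /\ {subset u :: p <= H} /\ size p <= 2.
Proof.
case/existsP=> u /andP[uH exu]; case/existsP=> w /andP[wH eyw].
have [p [pp lp up sub sp]] := H_path uH wH.
by exists u, p; split=> //; split=> //; rewrite lp esym.
Qed.

Lemma no_bigger W s : packable e c k W -> c_chorded e c s ->
  [disjoint [set x in s] & W] -> #|L| < size s + #|W| -> False.
Proof.
move=> pW cs dis lt; have := maxL (packable_cons cs dis pW).
by rewrite cardsU (disjoint_setI0 dis) cards0 subn0 cardsE (card_uniqP (c_chorded_uniq cs)); lia.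
Qed.

(** * Rerouting with reserved chords, and neighbours of [H] on one cycle *)

Definition chord_set (K : {set {set T}}) : Prop :=
  c <= #|K| /\ forall E, E \in K -> exists x y, e x y /\ E = [set x; y].

Lemma path_del (K : {set {set T}}) u p :
  path e u p -> {in u :: p, forall z, z \notin cover K} -> path (del e K) u p.
Proof.
move=> + out; have {out} : all (fun z => z \notin cover K) (u :: p) by apply/allP.
elim: p u => //= w p IH u /and3P[ou ow op] /andP[euw pp].
by rewrite del_notin //= IH //= ow.
Qed.

(** A path through [H] joins the attached ends, so all that the packing of [W] leaves of [L] would
    form one cycle with at least one vertex of [H], against the maximality of [L]. *)
Lemma no_close (K : {set {set T}}) W a t :
  packable e c k W -> W \subset L -> [set x in a :: t] = L :\: W ->
  uniq (a :: t) -> t != [::] -> path (del e K) a t ->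
  chord_set K -> cover K \subset [set x in a :: t] ->
  att a -> att (last a t) -> False.
Proof.
move=> pW sWL EW ut t0 pt [cK edge] covK attA attL.
have [u [p [[pp e1 e2 up] [sub sp]]]] := att_path attL attA.
have inL z : z \in a :: t -> z \in L.
  by move=> zt; have : z \in [set x in a :: t]; [rewrite inE | rewrite EW inE => /andP[]].
have out z : z \in H -> z \notin cover K.
  rewrite inE; apply: contra => /(subsetP covK); rewrite inE; exact: inL.
have cy : is_cycle (del e K) (a :: t ++ u :: p).
  apply/and3P; split.
  - rewrite -cat_cons cat_uniq ut up andbT; apply/hasPn => z /sub; rewrite in_setC => zL.
    by apply/negP => /= /inL zL'; rewrite zL' in zL.
  - by case: (t) t0 => //= b t' _; rewrite size_cat addnS.
  - rewrite /= rcons_path cat_path pt /= last_cat /=.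
    rewrite (del_sym esym) del_notin ?out ?sub ?mem_head //= 1?esym // path_del //=.
      by rewrite del_notin ?out ?sub ?mem_last.
    by move=> z /sub/out.
have cc : c_chorded e c (a :: t ++ u :: p).
  apply: (del_cycle_chorded cy cK) => //; apply: subset_trans covK _.
  by apply/subsetP => z; rewrite !in_set -cat_cons mem_cat => ->.
apply: (no_bigger pW cc).
  apply/pred0P => z /=; rewrite in_set -cat_cons mem_cat; apply/negP => /andP[/orP[zt|/sub zH]] zW.
    by have : z \in [set x in a :: t]; [rewrite inE | rewrite EW inE zW].
  by move: zH; rewrite in_setC (subsetP sWL).
have : size (a :: t) = #|L :\: W| by rewrite -EW cardsE (card_uniqP ut).
have := cardsID W L; rewrite (setIidPr sWL) => h1 h2; rewrite -cat_cons size_cat h2 -h1 /=.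
by clear; lia.
Qed.

(** Otherwise, cut the cycle between its last and first vertex and apply [no_close], with all its
    chords reserved. *)
Lemma member_notatt_last a t : member (a :: t) -> att (last a t) -> ~~ att a.
Proof.
move=> mC attL; apply/negP => attA; have [cC sub pC] := mC.
have [/and3P[_ st _] nch] := andP cC.
have EW : [set x in a :: t] = L :\: (L :\: [set x in a :: t]).
  by rewrite setDDr setDv set0U (setIidPr sub).
have cy := cycle_del_chords eirr (subxx (chords e (a :: t))) (proj1 (andP cC)).
apply: (no_close (K := chords e (a :: t)) pC (subsetDl _ _) EW (member_uniq mC) _ _ _ _ attA attL).
- by case: (t) st.
- by case/and3P: cy => _ _; rewrite /= rcons_path => /andP[].
- by split=> // E /chordsP[x [y [_ _ exy _ ->]]]; exists x, y.
- apply/subsetP => z /bigcupP[E /chordsP[x [y [xs ys _ _ ->]]]].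
  by rewrite in_set2 inE => /orP[] /eqP ->.
Qed.

Lemma member_notatt_next a b t : member (a :: b :: t) -> att a -> ~~ att b.
Proof.
move=> /(member_rot 1); rewrite rot1_cons rcons_cons => /member_notatt_last.
by rewrite last_rcons.
Qed.

Lemma notatt_dgH b : ~~ att b -> dg e H b = 0.
Proof.
move/existsPn => nb; apply: dg0 => w wH; have := nb w; by rewrite wH.
Qed.

(** The degree condition applies to [b] and [u]; [b] has no neighbour in [H], and [u] has fewer than
    [#|H|]. *)
Lemma notatt_dg b u : b \in L -> ~~ att b -> u \in H -> #|L| < dg e L b + dg e L u.
Proof.
move=> bL nb uH.
have neq : b != u by apply: contraTneq bL => ->; rewrite -in_setC.
have nadj : ~~ e b u.
  by move/existsPn: nb => /(_ u); rewrite uH.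
have := sigma neq nadj; rewrite !degE (notatt_dgH nb) -cardH.
by have := dg_lt eirr uH; lia.
Qed.

Lemma notatt_dg2 b1 b2 : L != setT -> b1 \in L -> b2 \in L -> ~~ att b1 -> ~~ att b2 ->
  #|L| + 2 <= dg e L b1 + dg e L b2.
Proof.
move=> LT b1L b2L n1 n2.
have [u uH] : exists u, u \in H.
  by apply/set0Pn; apply: contra LT => /eqP E; rewrite -(setCK L) E setC0.
have := notatt_dg b1L n1 uH; have := notatt_dg b2L n2 uH; have := dgL_half uH; lia.
Qed.

Lemma exists_member : exists C, member C.
Proof.
have [[|C P] [sP pP]] := packL; first by [].
by exists C; apply: (member_of_packing pP sP); apply: mem_head.
Qed.

(** Some vertex [z] of a member is unattached; [notatt_dg] applies to it, and [z] has at most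
    [#|L| - 1] neighbours in [L]. *)
Lemma dgL_ge2 u : u \in H -> 2 <= dg e L u.
Proof.
move=> uH; have [[|a [|b t]] mC] := exists_member; [by have := member_size mC | by have := member_size mC |].
have [z zC nz] : exists2 z, z \in a :: b :: t & ~~ att z.
  case: (boolP (att a)) => [/(member_notatt_next mC) nb | na].
    by exists b; rewrite ?inE ?eqxx ?orbT.
  by exists a; rewrite ?mem_head.
have zL : z \in L by case: mC => _ /subsetP/(_ z); rewrite inE => /(_ zC).
by have := notatt_dg zL nz uH; have := dg_lt eirr zL; lia.
Qed.

(** Without [p], the cycle is a path from the head of [s] round to [x], with attached ends and all
    reserved chords still on it; [no_close] excludes this. *)
Lemma no_absorb_run (K : {set {set T}}) x p s :
  member (x :: p ++ s) -> s != [::] -> is_cycle (del e K) (x :: p ++ s) ->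
  chord_set K -> cover K \subset [set y in x :: p ++ s] ->
  (forall v, v \in p -> v \notin cover K) -> att x -> att (head x s) ->
  ~ packable e c k ((L :\: [set y in x :: p ++ s]) :|: [set y in p]).
Proof.
case: s => // a t [cC sub _] _ /and3P[_ _ cy] chK covK nK attx atta pW.
have uC := c_chorded_uniq cC.
have uC' : uniq (p ++ x :: a :: t).
  have : perm_eq (p ++ x :: a :: t) (x :: p ++ a :: t).
    by rewrite -cat1s perm_catCA.
  by move/perm_uniq->.
apply: (no_close (K := K) (a := a) (t := rcons t x) pW) => //.
- rewrite subUset subsetDl /=; apply: subset_trans sub; apply/subsetP => y.
  by rewrite !in_set in_cons mem_cat => ->; rewrite orbT.
- apply/setP => y; have := subsetP sub y.
  rewrite in_setD in_setU in_setD !in_set !in_cons !mem_cat !in_cons mem_rcons !in_cons.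
  move: uC'; rewrite cat_uniq => /and3P[_ /hasPn d _].
  have := d y; rewrite !inE /=; case: (y \in p); case: (y == x); case: (y == a); case: (y \in t) => //=;
  case: (y \in L) => //= h1 h2; by [have := h1 isT | have := h2 isT].
- move: uC'; rewrite cat_uniq => /and3P[_ _].
  by rewrite -rcons_cons rcons_uniq cons_uniq.
- by case: (t).
- move: cy; rewrite /= rcons_cat cat_path => /andP[_].
  by rewrite rcons_cons /= => /andP[].
- apply/subsetP => y yK; have := subsetP covK y yK; have := contraL (nK y) yK.
  by rewrite !in_set !in_cons mem_rcons in_cons mem_cat in_cons => /negbTE-> /=; case: (y == x); rewrite ?orbT.
- by rewrite last_rcons.
Qed.

(** From [s1] forwards to [x2], over [u] to [x1], then backwards to [s2]: of the cycle only [q1] and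
    [q2] are left out. *)
Lemma detour_path (e' : rel T) u x1 q1 s1 r1 z1 x2 q2 s2 r2 z2 :
  symmetric e' -> cycle e' (x1 :: (q1 ++ s1 :: r1) ++ z1 ++ x2 :: (q2 ++ s2 :: r2) ++ z2) ->
  e' u x1 -> e' u x2 ->
  path e' s1 ((r1 ++ z1 ++ [:: x2]) ++ u :: rev (s2 :: r2 ++ z2 ++ [:: x1])).
Proof.
move=> sym cy e1 e2.
have : path e' x1 (q1 ++ (s1 :: r1 ++ z1 ++ [:: x2]) ++ q2 ++ (s2 :: r2 ++ z2 ++ [:: x1])).
  move: cy; rewrite /= -cats1.
  by rewrite !(=^~ catA, cat_cons).
rewrite cat_path cat_path cat_path => /and4P[_ /= /andP[_ h1] _ /andP[_ h2]].
rewrite cat_path h1 /= !last_cat /= sym e2 /=.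
move: h2; rewrite -(rev_path_sym sym) (lastI s2) rev_rcons /= => h2.
by rewrite [last s2 _]last_cat last_cat /= e1 /=; move: h2; rewrite !last_cat.
Qed.

Lemma detour_perm (u x1 : T) q1 s1 r1 z1 x2 q2 s2 r2 z2 :
  perm_eq ((q1 ++ q2) ++ (s1 :: (r1 ++ z1 ++ [:: x2]) ++ u :: rev (s2 :: r2 ++ z2 ++ [:: x1])))
    (u :: x1 :: (q1 ++ s1 :: r1) ++ z1 ++ x2 :: (q2 ++ s2 :: r2) ++ z2).
Proof.
clear; apply/permP => a.
by do 5! rewrite ?(count_cat, count_rev) /=; lia.
Qed.

(** An instance of [absorption], where [Q] is packability by [k] cycles and [W0] is covered by the
    other cycles. [no_absorb_run] says that neither run is absorbed entirely; the conditions on [s1]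
    and [s2] hold because otherwise the detour through [u] closes to a cycle. *)
Lemma detour (K : {set {set T}}) u x1 p1 z1 x2 p2 z2
    (C := x1 :: p1 ++ z1 ++ x2 :: p2 ++ z2) :
  member C -> is_cycle (del e K) C -> chord_set K -> cover K \subset [set y in C] ->
  {in p1 ++ p2, forall v, v \notin cover K} -> {in p1 ++ p2, forall v, ~~ att v} ->
  u \in H -> e u x1 -> e u x2 -> att (head x2 z1) -> att (head x1 z2) -> False.
Proof.
move=> mC cy chK covK nK natt uH eu1 eu2 at1 at2.
(* Here [w] is [#|W0|], [q] the number of absorbed vertices, and [w1], [Q1], [L1] are the degrees of
   [s1] into [W0], the absorbed vertices and the path; [w2], [Q2], [L2] are those of [s2]. *)
have arith w1 w2 Q1 Q2 L1 L2 w q sA sC l : sA.+1 + q = sC.+1 -> w + sC = l ->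
    w1 + Q1 + (w2 + Q2) < w + q + 2 -> l + 2 <= w1 + (Q1 + L1) + (w2 + (Q2 + L2)) -> sA < L1 + L2.
  by clear; lia.
have [cC sub pC] := mC; have uC := c_chorded_uniq cC.
have attu x : e u x -> att x by move=> eux; apply/existsP; exists u; rewrite uH esym.
have uL : u \notin L by rewrite -in_setC.
have inL z : z \in C -> z \in L by move=> zC; apply: (subsetP sub); rewrite inE.
have outK z : z \notin C -> z \notin cover K.
  by apply: contra => /(subsetP covK); rewrite inE.
have uK : u \notin cover K by apply: outK; apply: contra uL; apply: inL.
have LT : L != setT by apply: contraNneq uL => ->; rewrite inE.
have pinC z : z \in p1 ++ p2 -> z \in C.
  rewrite /C !inE !mem_cat !inE !mem_cat.
  by case/orP=> ->; rewrite ?orbT.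
have up : uniq (p1 ++ p2).
  have : perm_eq ((p1 ++ p2) ++ (x1 :: z1 ++ x2 :: z2)) C.
    by clear; apply/permP => a; rewrite /C; do 4! rewrite ?count_cat /=; lia.
  by move/perm_uniq; rewrite uC cat_uniq => /and3P[].
set W0 := L :\: [set y in C].
have dis0 (s : seq T) : {subset s <= C} -> [disjoint W0 & [set y in s]].
  by move=> ss; apply/pred0P => z /=; rewrite in_setD !in_set; apply/negP => /andP[/andP[/negP h _] /ss].
have cC' : #|W0| + size C = #|L|.
  have <- : #|[set y in C]| = size C by rewrite cardsE; apply/card_uniqP.
  by rewrite -(cardsID [set y in C] L) (setIidPr sub) addnC.
have dgL v : dg e L v = dg e W0 v + count (e v) C.
  by rewrite (dgID e [set y in C]) (setIidPr sub) dg_set // addnC.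
have cond i j : i < size p1 -> j < size p2 ->
    packable e c k (W0 :|: [set y in take i p1 ++ take j p2]) ->
    let s1 := nth x1 p1 i in let s2 := nth x1 p2 j in
    let W := W0 :|: [set y in take i p1 ++ take j p2] in
    ~~ e s1 s2 /\ #|W| + 2 <= dg e W s1 + dg e W s2.
  move=> li lj pW s1 s2 W; rewrite -/W in pW.
  set q1 := take i p1 in W pW *; set q2 := take j p2 in W pW *.
  have E1 : p1 = q1 ++ s1 :: drop i.+1 p1 by rewrite -drop_nth // cat_take_drop.
  have E2 : p2 = q2 ++ s2 :: drop j.+1 p2 by rewrite -drop_nth // cat_take_drop.
  set r1 := drop i.+1 p1 in E1; set r2 := drop j.+1 p2 in E2.
  (* [s1 :: A] is a path from [s1] to [s2] through [u] that covers [u] and all vertices of [C]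
     not yet absorbed by the other cycles. *)
  set A := (r1 ++ z1 ++ [:: x2]) ++ u :: rev (s2 :: r2 ++ z2 ++ [:: x1]).
  have s1p : s1 \in p1 ++ p2 by rewrite mem_cat mem_nth.
  have s2p : s2 \in p1 ++ p2 by rewrite mem_cat orbC mem_nth.
  have pA : path (del e K) s1 A.
    apply: (@detour_path _ u x1 q1 s1 r1 z1 x2 q2 s2 r2 z2); first exact: del_sym.
    - by rewrite -E1 -E2; case/and3P: cy.
    - by rewrite del_notin.
    - by rewrite del_notin.
  have perm : perm_eq ((q1 ++ q2) ++ s1 :: A) (u :: C).
    by rewrite /C E1 E2; apply: detour_perm.
  have lA : last s1 A = s2.
    by rewrite /A last_cat /= rev_cons last_rcons.
  have subq : {subset q1 ++ q2 <= p1 ++ p2}.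
    by move=> z; rewrite !mem_cat => /orP[] /mem_take ->; rewrite ?orbT.
  have uall : uniq ((q1 ++ q2) ++ s1 :: A).
    by rewrite (perm_uniq perm) cons_uniq uC andbT; apply: contra uL; apply: inL.
  have [uq dqA uA] : [/\ uniq (q1 ++ q2), {in s1 :: A, forall z, z \notin q1 ++ q2} & uniq (s1 :: A)].
    by move: uall; rewrite cat_uniq => /and3P[? /hasPn ? ?].
  have szq : size (s1 :: A) + size (q1 ++ q2) = (size C).+1.
    by rewrite -[RHS]/(size (u :: C)) -(perm_size perm) (size_cat (q1 ++ q2)) addnC.
  have subqC : {subset q1 ++ q2 <= C} by move=> z /subq/pinC.
  have cW : #|W| = #|W0| + size (q1 ++ q2) by apply: cardU_seq => //; apply: dis0.
  have dW v : dg e W v = dg e W0 v + count (e v) (q1 ++ q2) by apply: dgU_seq => //; apply: dis0.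
  have cnt v : ~~ e v u -> count (e v) (q1 ++ q2) + count (e v) (s1 :: A) = count (e v) C.
    move=> /negbTE nvu; rewrite -[LHS]count_cat (permP perm).
    by have -> : count (e v) (u :: C) = e v u + count (e v) C by []; rewrite nvu add0n.
  have memA z : z \in s1 :: A -> z = u \/ z \in C.
    move=> zA; have : z \in u :: C by rewrite -(perm_mem perm) mem_cat zA orbT.
    by rewrite in_cons => /orP[/eqP|]; [left|right].
  (* Such a cycle keeps the reserved chords and, together with the packing of [W], covers [L] and
     [u]. *)
  have close s : perm_eq s (s1 :: A) -> is_cycle (del e K) s -> False.
    move=> ps cs; apply: (@no_bigger W s pW).
    - apply: (del_cycle_chorded cs (proj1 chK)); last exact: (proj2 chK).
      apply/subsetP => z zK; rewrite in_set (perm_mem ps).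
      have zC : z \in C by have := subsetP covK z zK; rewrite in_set.
      have := perm_mem perm z; rewrite mem_cat (in_cons u) zC orbT => /orP[/subq /nK|//].
      by rewrite zK.
    - apply/pred0P => z /=; rewrite in_set (perm_mem ps) in_setU in_setD !in_set.
      apply/negP => /andP[zA /orP[/andP[zC zL]|zq]]; last by have := uA; have := dqA z zA; rewrite zq.
      by case: (memA z zA) => [E|h]; [rewrite E (negbTE uL) in zL | rewrite h in zC].
    - by rewrite (perm_size ps) cW -cC' addnCA ltn_add2l szq.
  have n1 := natt _ s1p; have n2 := natt _ s2p.
  have nu v : ~~ att v -> ~~ e v u by apply: contra; rewrite esym; apply: attu.
  have szA : 1 < size A by rewrite /A !size_cat /= !addn1 !addnS !addSn.
  split.
    apply/negP => es; apply: (close (s1 :: A)); first exact: perm_refl.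
    apply/and3P; split=> //.
    by rewrite /= rcons_path pA lA (del_sym esym) del_notin ?nK.
  (* [s1] and [s2] have degree sum at least [#|L| + 2] in [L]; if too little of it fell on [W], the
     rest would close the path [s1 :: A]. *)
  rewrite leqNgt; apply/negP => lt.
  have dK v : v \in p1 ++ p2 -> count (del e K v) (s1 :: A) = count (e v) (s1 :: A).
    move=> vp; apply: eq_count => z; apply/idP/idP; first exact: (@del_sub _ _ K).
    by apply: del_notin; apply: nK.
  have [|s [ps cs]] := path_close (del_sym esym K) (del_irr eirr K) pA uA szA.
    rewrite lA !dK //.
    have := notatt_dg2 LT (inL _ (pinC _ s1p)) (inL _ (pinC _ s2p)) n1 n2.
    rewrite !dgL -!cnt ?nu //; move: lt; rewrite !dW cW; exact: arith szq cC'.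
  exact: (close s).
have headE (x y : T) z s : head x (z ++ y :: s) = head y z by case: z.
apply: (@absorption T e esym (packable e c k) W0 p1 p2 x1 up (dis0 _ pinC) pC).
- move=> A v pA vA lt.
  have -> : v |: A = A :|: [set y in [:: v]] by apply/setP => y; rewrite !inE orbC.
  apply: (packable_insert esym eirr (p := [::]) pA) => //.
  by apply/pred0P => y /=; rewrite !inE; apply: contraNF vA => /andP[yA /eqP <-].
- by move=> i j li lj pW; have [] := cond i j li lj pW.
- by move=> i j li lj pW; have [] := cond i j li lj pW.
- apply: (@no_absorb_run K x1 p1 (z1 ++ x2 :: p2 ++ z2)) => //; first by case: (z1).
  + by move=> v vp; apply: nK; rewrite mem_cat vp.
  + exact: attu.
  + by rewrite headE.
(* The second run is handled by turning the cycle to start at [x2]. *)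
- have CE : rot (size (x1 :: p1 ++ z1)) C = x2 :: p2 ++ (z2 ++ x1 :: p1 ++ z1).
    have -> : C = (x1 :: p1 ++ z1) ++ (x2 :: p2 ++ z2) by rewrite /C /= -catA.
    by rewrite rot_size_cat /= -catA.
  have SE : [set y in C] = [set y in x2 :: p2 ++ (z2 ++ x1 :: p1 ++ z1)].
    by apply/setP => y; rewrite -CE !in_set mem_rot.
  rewrite /W0 SE; apply: (no_absorb_run (K := K)) => //.
  + by rewrite -CE; apply: member_rot.
  + by case: (z2).
  + by rewrite -CE is_cycle_rot.
  + by rewrite -SE.
  + by move=> v vp; apply: nK; rewrite mem_cat vp orbT.
  + exact: attu.
  + by rewrite headE.
Qed.

(** The default [y] stands for the vertex that follows [w] on the cycle, for a run that reaches the
    end of [w]. *)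
Lemma att_head y w : att y -> att (head y (drop (find att w) w)).
Proof.
move=> ay; rewrite -nth0 nth_drop addn0; case: (boolP (has att w)) => hw; first exact: nth_find.
by rewrite nth_default // leqNgt -has_find.
Qed.

(* [c] chords have at most [2 * c] endpoints, so if [u] had [2 * c + 2] neighbours on [C], then
   the runs following two of them would contain no endpoint, and [detour] would apply. *)
Lemma nbr_bound C u : member C -> u \in H -> count (e u) C <= 2 * c + 1.
Proof.
move=> mC uH; rewrite leqNgt; apply/negP => lt.
have attu x : e u x -> att x by move=> eux; apply/existsP; exists u; rewrite uH esym.
(* The cycle is read from a neighbour of [u], so that a run reaching the end of the list is followed
   by an attached vertex. *)
have [x0 x0C eux0] : exists2 x, x \in C & e u x by apply/hasP; rewrite has_count; apply: leq_ltn_trans lt.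
have [i0 w0 E0] := rot_to x0C.
have {}lt : 2 * c + 1 < count (e u) (x0 :: w0).
  by rewrite -E0; have /permP-> : perm_eq (rot i0 C) C by rewrite perm_rot.
have {}mC : member (x0 :: w0) by rewrite -E0; apply: member_rot.
have [cC sub _] := mC; have uC := c_chorded_uniq cC; have /andP[cyC leC] := cC.
set A := chords e (x0 :: w0) in leC.
pose K := [set E in take c (enum A)].
have KA : K \subset A by apply/subsetP => E; rewrite in_set => /mem_take; rewrite mem_enum.
have cK : #|K| = c.
  by rewrite cardsE (card_uniqP _) ?take_uniq ?enum_uniq // size_takel // -cardE.
have covK : cover K \subset [set y in x0 :: w0].
  apply/subsetP => z /bigcupP[E /(subsetP KA)/chordsP[x [y [xs ys _ _ ->]]]].
  by rewrite in_set2 in_set => /orP[] /eqP ->.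
have cover2 : #|cover K| <= 2 * c.
  apply: leq_trans (leq_card_cover K) _; rewrite -cK mulnC -sum_nat_const.
  apply: leq_sum => E /(subsetP KA)/chordsP[x [y [_ _ _ _ ->]]].
  by rewrite cards2; case: (x != y).
have cntK : count (mem (cover K)) (x0 :: w0) <= #|cover K|.
  rewrite -size_filter -(card_uniqP (filter_uniq _ uC)); apply/subset_leq_card/subsetP => z.
  by rewrite mem_filter => /andP[].
have [|s0 [x1 [w1 [x2 [w2 [EC eu1 eu2 f1 f2]]]]]] := @two_free _ (e u) (mem (cover K)) (x0 :: w0).
  by apply: leq_ltn_trans lt; rewrite leq_add2r; apply: leq_trans cntK cover2.
(* Neighbours of [u] are attached, so the run up to the next attached vertex is an initial part of
   the stretch given by [two_free]. *)
have run w v : ~~ has (mem (cover K)) (take (find (e u) w) w) ->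
    v \in take (find att w) w -> v \notin cover K /\ ~~ att v.
  move=> nK vw; split.
    apply: contra nK => vK; apply/hasP; exists v => //.
    have le : find att w <= find (e u) w by apply: sub_find => y; apply: attu.
    by move: vw; rewrite -(take_takel w le) => /mem_take.
  apply/negP => av; have : 0 < count att (take (find att w) w) by rewrite -has_count; apply/hasP; exists v.
  by rewrite count_take_find.
have CE : rot (size s0) (x0 :: w0) =
    x1 :: take (find att w1) w1 ++ drop (find att w1) w1 ++
      x2 :: take (find att w2) w2 ++ drop (find att w2) w2 ++ s0.
  rewrite EC rot_size_cat /= -catA /=; congr (_ :: _).
  rewrite [RHS]catA cat_take_drop; congr (_ ++ _ :: _).
  by rewrite [RHS]catA cat_take_drop.
apply: (@detour K u x1 (take (find att w1) w1) (drop (find att w1) w1) x2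
         (take (find att w2) w2) (drop (find att w2) w2 ++ s0)) => //.
- by rewrite -CE; apply: member_rot.
- rewrite -CE is_cycle_rot; exact: cycle_del_chords.
- split; first by rewrite cK.
  by move=> E /(subsetP KA)/chordsP[x [y [_ _ exy _ ->]]]; exists x, y.
- by apply: subset_trans covK _; apply/subsetP => y; rewrite -CE !in_set mem_rot.
- by move=> v; rewrite mem_cat => /orP[/run[]|/run[]].
- by move=> v; rewrite mem_cat => /orP[/run[]|/run[]].
- exact/att_head/attu.
- have -> : head x1 (drop (find att w2) w2 ++ s0) = head (head x1 s0) (drop (find att w2) w2).
    by case: (drop _ _).
  apply: att_head; case: (s0) EC => [|y s] /= [E _]; first exact: attu.
  by rewrite -E; apply: attu.
Qed.

(** * A long cycle and the contradiction it leads to *)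

Lemma uniq_catI (s1 s2 : seq T) :
  uniq s1 -> uniq s2 -> {in s1, forall z, z \notin s2} -> uniq (s1 ++ s2).
Proof.
move=> u1 u2 h; rewrite cat_uniq u1 u2 andbT; apply/hasPn => z z2; apply/negP => /= /h.
by rewrite z2.
Qed.

Lemma path_splice s1 A u p s2 B :
  path e s1 A -> path e u p -> path e s2 B -> e (last s1 A) u -> e (last u p) (last s2 B) ->
  path e s1 (A ++ (u :: p) ++ rev (s2 :: B)) /\
  last s1 (A ++ (u :: p) ++ rev (s2 :: B)) = s2.
Proof.
move=> pA pp pB e1 e2; split; last by rewrite !last_cat /= rev_cons last_rcons.
rewrite cat_path pA /= e1 cat_path pp /= (lastI s2) rev_rcons /= e2.
by rewrite (rev_path_sym esym).
Qed.

Lemma count_flatten_le (a : pred T) P B :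
  (forall s, s \in P -> count a s <= B) -> count a (flatten P) <= size P * B.
Proof.
elim: P => //= s P IH h; rewrite count_cat mulSn; apply: leq_add; first exact/h/mem_head.
by apply: IH => s' s'P; apply: h; rewrite inE s'P orbT.
Qed.

Lemma max_size (P : seq (seq T)) : P != [::] ->
  exists2 C, C \in P & forall s, s \in P -> size s <= size C.
Proof.
elim: P => // s [|s' P] IH _.
  by exists s; rewrite ?mem_head // => s'; rewrite inE => /eqP->.
have [C CP max] := IH isT.
case: (leqP (size s) (size C)) => [le | lt].
  exists C; first by rewrite inE CP orbT.
  by move=> t; rewrite inE => /orP[/eqP->|/max].
exists s; first exact: mem_head.
move=> t; rewrite inE => /orP[/eqP->//|/max le]; exact: ltnW (leq_ltn_trans le lt).
Qed.

(** By Ore's theorem a cycle spans [H]. If [#|H|] is at least [2 * c + 4], some vertex of [H] has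
    [c + 2] neighbours in [H], so this cycle is [c]-chorded and could replace a shorter [C]. *)
Lemma card_H_bound C : member C -> #|H| <= size C \/ #|H| <= 2 * c + 3.
Proof.
move=> mC; case: (leqP #|H| (size C)) => [|lt]; [by left | right].
rewrite leqNgt; apply/negP => ge.
have [cC sub pC] := mC; have sC := member_size mC.
have [|s [cs Es]] := ore esym eirr _ H_ore; first exact: leq_trans sC (ltnW lt).
have us : uniq s by case/and3P: cs.
have SE : [set x in s] = H by apply/setP => z; rewrite in_set Es.
have szs : size s = #|H| by rewrite -SE cardsE (card_uniqP us).
have [v vH dv] : exists2 v, v \in H & c + 2 <= dg e H v.
  have [v0 v0H] : exists v, v \in H by apply/card_gt0P; apply: leq_ltn_trans lt.
  case: (boolP [exists w in H, (w != v0) && ~~ e v0 w]).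
    case/exists_inP=> w wH /andP[neq nadj]; rewrite eq_sym in neq.
    have := H_ore v0H wH neq nadj.
    case: (leqP (c + 2) (dg e H v0)) => [h _|h1 h2]; first by exists v0.
    by exists w => //; move: ge h1 h2; clear; lia.
  move/exists_inPn => all; exists v0 => //.
  have : #|H :\ v0| <= dg e H v0.
    apply/subset_leq_card/subsetP => w; rewrite in_setD1 => /andP[neq wH].
    by rewrite inE wH; have := all w wH; rewrite neq negbK.
  by have := cardsD1 v0 H; rewrite v0H; move: ge; clear; lia.
apply: (@no_bigger (L :\: [set x in C]) s pC).
- by apply: (deg_chorded eirr cs (v := v)); rewrite ?Es // -dg_set // SE.
- rewrite SE; apply/pred0P => z /=; rewrite in_setC in_setD; case: (z \in L) => //=; by rewrite andbF.
- have := cardsID [set x in C] L; rewrite (setIidPr sub) cardsE (card_uniqP (member_uniq mC)) szs.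
  by move: lt; clear; lia.
Qed.

(** This is where the order of [G] enters. A longest cycle [C] has [#|L| <= k.+1 * size C]; if also
    [#|H| <= size C] and [C] had at most [M = 8 * k.+1 * c + 2 * c - 4] vertices, then [#|T|] would
    be at most [k.+2 * M], which is [fkc k.+1 c - 5]. *)
Lemma large_member : fkc k.+1 c <= #|T| ->
  exists C P, [/\ packing e c (C :: P) L, size P = k & 8 * k.+1 * c + 2 * c <= size C + 3].
Proof.
move=> large; have [P0 [sP0 pP0]] := packL.
have [|C CP max] := @max_size P0; first by case: (P0) sP0.
have mC := member_of_packing pP0 sP0 CP.
have [P [sP pP]] := packing_pick pP0 CP.
exists C, P; split=> //; first by move: sP; rewrite sP0 => -[].
have cL : #|L| <= k.+1 * size C.
  case: pP0 => _ u0 <-; rewrite cardsE (card_uniqP u0) -sP0 -count_predT.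
  by apply: count_flatten_le => s /max; rewrite count_predT.
have := card_H_bound mC; move: large cL; rewrite -cardH /fkc; move: #|L| #|H| (size C) c_gt0.
clear; move=> l h s c0 f1 f2 hh.
rewrite leqNgt; apply/negP => lt.
(* The truncated subtraction in [fkc] is moved to the other side. *)
have {}f1 : 8 * k.+1 ^ 2 * c + 10 * k.+1 * c + 2 * c + 1 <= l + h + 4 * k.+1 by lia.
rewrite -mulnn in f1.
case: hh => hh; nia.
Qed.

(** By [notatt_dg], [b] misses fewer than [dg e L u] vertices of [L]. It misses itself, which lies
    in [L :\: R] if [b \notin R]; this gives the extra one. *)
Lemma notatt_dense (R : {set T}) b u : b \in L -> ~~ att b -> R \subset L -> u \in H ->
  #|R| + (b \notin R) < dg e R b + dg e L u.
Proof.
move=> bL nb sR uH; have := notatt_dg bL nb uH.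
have := dgID e R L b; rewrite (setIidPr sR); have := cardsID R L; rewrite (setIidPr sR).
have : dg e (L :\: R) b + (b \notin R) <= #|L :\: R|.
  case: (boolP (b \in R)) => bR /=; first by rewrite addn0 dg_le.
  by rewrite addn1; apply: dg_lt; rewrite // in_setD bR.
clear; lia.
Qed.

(** Otherwise the path from the successor [s1] of [x] to [y], through [H] to [x] and backwards to
    the successor [s2] of [y] covers [C]. Its ends are unattached and miss few vertices of [C], so
    it closes; the chords come from the degree of [s1]. *)
Lemma att_inj C x y : member C -> 8 * k.+1 * c + 2 * c <= size C + 3 ->
  x \in C -> y \in C -> att x -> att y -> x = y.
Proof.
move=> mC large xC yC ax ay; apply/eqP/negPn/negP => neq.
have [i w E] := rot_to xC.
have {}mC : member (x :: w) by rewrite -E; apply: member_rot.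
have {}large : 8 * k.+1 * c + 2 * c <= size (x :: w) + 3 by rewrite -E size_rot.
have : y \in x :: w by rewrite -E mem_rot.
rewrite inE eq_sym (negbTE neq) /= => /splitPr yw.
case: yw mC large => w1 w2 mC large {E}.
case: w1 mC large => [|s1 r1] mC large.
  by have := member_notatt_next mC ax; rewrite ay.
case: w2 mC large => [|s2 r2] mC large.
  have := member_notatt_last mC; rewrite /= last_cat /= => /(_ ay); by rewrite ax.
have n1 : ~~ att s1 := member_notatt_next mC ax.
have n2 : ~~ att s2.
  have := member_rot (size (x :: s1 :: r1)) mC.
  rewrite -[x :: (s1 :: r1) ++ _]/((x :: s1 :: r1) ++ y :: s2 :: r2) rot_size_cat.
  by move/member_notatt_next; apply.
set C' := x :: _ in mC large.
have [cC sub pC] := mC; have uC := c_chorded_uniq cC.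
have inL z : z \in C' -> z \in L by move=> zC; apply: (subsetP sub); rewrite inE.
have [u [p [[pp e1 e2 up] [subH sp]]]] := att_path ay ax.
set A := (r1 ++ [:: y]) ++ (u :: p) ++ rev (s2 :: r2 ++ [:: x]).
have cyp : path e x ((s1 :: r1 ++ [:: y]) ++ (s2 :: r2 ++ [:: x])).
  have /and3P[_ _] := proj1 (andP cC).
  by rewrite /C' /= rcons_cat /= -cats1 -!catA.
move: cyp; rewrite cat_path => /andP[/= /andP[_ pA0] /andP[_ pB0]].
have [pA lA] : path e s1 A /\ last s1 A = s2.
  by apply: path_splice => //; rewrite last_cat.
have perm : perm_eq (s1 :: A) ((u :: p) ++ C').
  clear; apply/permP => a; rewrite /A /C'; do 5! rewrite ?(count_cat, count_rev) /=; lia.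
have uA : uniq (s1 :: A).
  rewrite (perm_uniq perm); apply: uniq_catI => // z /subH; rewrite in_setC.
  by apply: contra; apply: inL.
have szA : size (s1 :: A) = (size p).+1 + size C' by rewrite (perm_size perm) size_cat.
have uH : u \in H by apply: subH; apply: mem_head.
have dgu : dg e L u <= k.+1 * (2 * c + 1).
  have [P [sP pP]] := packL; have [_ uP <-] := pP; rewrite dg_set // -sP.
  by apply: count_flatten_le => s sIn; apply: nbr_bound uH; apply: member_of_packing pP sP sIn.
have cnt b : b \in C' -> ~~ att b -> size C' < count (e b) C' + k.+1 * (2 * c + 1).
  move=> bC nb; have := notatt_dense (inL _ bC) nb sub uH.
  rewrite dg_set // cardsE (card_uniqP uC) in_set bC addn0.
  by move/leq_trans; apply; rewrite leq_add2l.
have s1C : s1 \in C' by rewrite !inE eqxx orbT.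
have s2C : s2 \in C' by rewrite /C' !(inE, mem_cat) eqxx !orbT.
have cntA b : count (e b) C' <= count (e b) (s1 :: A).
  by rewrite (permP perm) count_cat leq_addl.
have := cntA s1; have := cntA s2; have := cnt s1 s1C n1; have := cnt s2 s2C n2.
(* The first bound closes the path, which has up to three vertices in [H]; the second gives [s1] at
   least [c + 2] neighbours. *)
have bnd : (k.+1 * (2 * c + 1)).*2 + 1 <= size C' /\ k.+1 * (2 * c + 1) + c + 1 <= size C'.
  by move: large c_gt0; move: (size C'); clear; nia.
case: bnd => bnd1 bnd2 k2 k1 l2 l1.
have [||s [ps cs]] := path_close esym eirr pA uA.
- by move: szA bnd1 sp; move: (size C') => n /=; clear; lia.
- rewrite lA; move: szA bnd1 sp k1 k2 l1 l2; move: (count _ _) (count _ _) (count _ _) (count _ _) (size C') => n1' n2' n3' n4' n /=; clear; lia.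
apply: (no_bigger pC (s := s)).
- apply: (deg_chorded eirr cs (v := s1)); first by rewrite (perm_mem ps) mem_head.
  have /permP-> := ps; apply: leq_trans l1; move: k1 bnd2; clear; lia.
- apply/pred0P => z /=; rewrite in_set (perm_mem ps) (perm_mem perm) mem_cat in_setD in_set.
  apply/negP => /andP[/orP[/subH zH|->//] /andP[_ zL]]; by rewrite in_setC zL in zH.
- have := cardsID [set x in C'] L; rewrite (setIidPr sub) cardsE (card_uniqP uC) (perm_size ps) szA.
  by move=> <-; rewrite ltn_add2r addSn ltnS leq_addl.
Qed.

(** By [notatt_dense], [R] is dense with [d = dg e L u - 2], and the ends of the path, lying outside
    [R], also miss at most [d] of its vertices. So [dense_absorb] packs [R] and the path into
    [r + 1] cycles, too many vertices in all. *)
Lemma no_dense_absorb r m (R Wr : {set T}) s1 A u :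
  packable e c m Wr -> r + m = k -> path e s1 A -> uniq (s1 :: A) ->
  [disjoint R & [set x in s1 :: A]] -> [disjoint Wr & R :|: [set x in s1 :: A]] ->
  R \subset L -> {in R, forall z, ~~ att z} ->
  (forall z, z \in [:: s1; last s1 A] -> z \in L /\ ~~ att z) -> u \in H ->
  2 * dg e L u + c + r * (c + 3) <= #|R| + 1 ->
  #|L| < #|R| + size (s1 :: A) + #|Wr| -> False.
Proof.
move=> pW rm pA uA dRA dW sRL nR ends uH large big.
have du := dgL_ge2 uH.
have dn z : z \in [:: s1; last s1 A] -> #|R| <= dg e R z + (dg e L u - 2).
  move=> zs; have [zL nz] := ends z zs.
  have zR : z \notin R.
    have zA : z \in s1 :: A.
      by move: zs; rewrite in_cons mem_seq1 => /orP[] /eqP->; [apply: mem_head | apply: mem_last].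
    apply/negP => zR; move/disjoint_setI0/setP: dRA => /(_ z).
    by rewrite in_setI zR in_set zA in_set0.
  by have := notatt_dense zL nz sRL uH; rewrite zR; move: du; clear; lia.
have dense : dense e R (dg e L u - 2).
  move=> z zR; have := notatt_dense (subsetP sRL z zR) (nR z zR) sRL uH.
  by move: du; clear; lia.
have pRA : packable e c r.+1 (R :|: [set x in s1 :: A]).
  apply: (dense_absorb esym eirr dense pA uA dRA).
  - by apply: dn; rewrite mem_head.
  - by apply: dn; rewrite !inE eqxx orbT.
  - by move: large du; clear; lia.
have dis : [disjoint R :|: [set x in s1 :: A] & Wr] by rewrite disjoint_sym.
have := packableU dis pRA pW; rewrite addSn rm => /maxL.
rewrite cardsU (disjoint_setI0 dis) cards0 subn0 cardU_seq //.
by rewrite leqNgt big.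
Qed.

(** [D] lists the vertices of [r + 1] cycles that are broken up, [P] the cycles that are kept. The
    path uses [Hs] and all of [D] except [R0], which has to absorb it. *)
Lemma no_reroute r P R0 Hs D s1 A u :
  packing e c P (L :\: [set z in D]) -> r + size P = k -> uniq D -> {subset D <= L} ->
  path e s1 A -> perm_eq ((s1 :: A) ++ R0) (Hs ++ D) ->
  uniq Hs -> Hs != [::] -> {subset Hs <= H} -> {in R0, forall z, z \in D /\ ~~ att z} ->
  s1 \in D -> last s1 A \in D -> ~~ att s1 -> ~~ att (last s1 A) -> u \in H ->
  2 * dg e L u + c + r * (c + 3) <= size R0 + 1 -> False.
Proof.
move=> pP rP uD subD pA perm uHs nHs subHs nR s1D lD n1 n2 uH large.
have uall : uniq ((s1 :: A) ++ R0).
  rewrite (perm_uniq perm); apply: uniq_catI => // z /subHs; rewrite in_setC.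
  by apply: contra; apply: subD.
have [uA dAR uR] : [/\ uniq (s1 :: A), {in R0, forall z, z \notin s1 :: A} & uniq R0].
  by move: uall; rewrite cat_uniq => /and3P[? /hasPn ? ?].
have sDL : [set z in D] \subset L by apply/subsetP => z; rewrite in_set; apply: subD.
apply: (@no_dense_absorb r (size P) [set z in R0] (L :\: [set z in D]) s1 A u) => //.
- by exists P.
- by apply/pred0P => z /=; rewrite !in_set; apply/negP => /andP[/dAR/negP].
- apply/pred0P => z /=; rewrite in_setU in_setD !in_set; apply/negP => /andP[/andP[zD zL]].
  have := perm_mem perm z; rewrite !mem_cat orbC => ->; rewrite (negbTE zD) orbF => /subHs.
  by rewrite in_setC zL.
- by apply/subsetP => z; rewrite in_set => /nR[/subD].
- by move=> z; rewrite in_set => /nR[].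
- by move=> z; rewrite in_cons mem_seq1 => /orP[] /eqP->; split=> //; apply: subD.
- by rewrite cardsE (card_uniqP uR).
rewrite cardsE (card_uniqP uR) -(cardsID [set z in D] L) (setIidPr sDL) cardsE (card_uniqP uD).
rewrite ltn_add2r addnC -size_cat (perm_size perm) size_cat -[X in X < _]add0n ltn_add2r.
by case: (Hs) nHs.
Qed.

Lemma rot_notatt C x : member C -> x \in C -> att x ->
  exists i s r, [/\ rot i C = x :: s :: r, ~~ att s, path e s (rcons r x) & e x s].
Proof.
move=> mC xC ax; have [i w E] := rot_to xC.
have mC' := member_rot i mC; rewrite E in mC'.
case: w E mC' => [|s r] E mC'; first by have := member_size mC'.
have [/andP[/and3P[_ _ /= /andP[exs cy]] _] _ _] := mC'.
by exists i, s, r; split=> //; apply: member_notatt_next mC' ax.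
Qed.

Lemma count_le1 (a : pred T) s : uniq s -> {in s &, forall x y, a x -> a y -> x = y} -> count a s <= 1.
Proof.
move=> us h; rewrite -size_filter; have := filter_uniq a us.
case E: (filter a s) => [|x [|y t]] // /andP[nx _].
have : x \in filter a s by rewrite E mem_head.
have : y \in filter a s by rewrite E !inE eqxx orbT.
rewrite !mem_filter => /andP[ay ys] /andP[ax xs].
by rewrite (h x y) // mem_head in nx.
Qed.

(** The long cycle has room for one fan even if two of its vertices lie on the path. The bound on
    [a], the degree of [u] into [L], allows one neighbour on the long cycle and [2 * c + 1] on each
    other cycle. *)
Lemma room_one N a : 0 < k -> 8 * k.+1 * c + 2 * c <= N + 3 -> a <= 1 + k * (2 * c + 1) ->
  2 * a + c + 1 * (c + 3) + 1 <= N.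
Proof.
move=> k0 large le; have : k <= k * c by rewrite leq_pmulr.
by move: c_gt0 k0 large le; clear; lia.
Qed.

Lemma room_two N a : 1 < k -> 8 * k.+1 * c + 2 * c <= N + 3 -> a <= 1 + k * (2 * c + 1) ->
  2 * a + c + 2 * (c + 3) <= N + 1.
Proof.
move=> k0 large le; have : k <= k * c by rewrite leq_pmulr.
by move: c_gt0 k0 large le; clear; lia.
Qed.

(** A vertex [u] of [H] has at least two neighbours in [L] but at most one on the long cycle [C], so
    other cycles can be opened at its neighbours and rerouted through [H]. *)
Lemma all_covered : fkc k.+1 c <= #|T| -> L = setT.
Proof.
move=> large; apply/eqP/negPn/negP => LT.
have [u uH] : exists u, u \in H.
  by apply/set0Pn; apply: contra LT => /eqP E; rewrite -(setCK L) E setC0.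
have [C [P [pCP sP bigC]]] := large_member large.
have memb C1 : C1 \in C :: P -> member C1.
  by move=> C1P; apply: (member_of_packing pCP) C1P; rewrite /= sP.
have mC := memb C (mem_head _ _).
have [cC sCL pP] := packing_uncons pCP; have uC := c_chorded_uniq cC.
have attu x : e u x -> att x by move=> eux; apply/existsP; exists u; rewrite uH esym.
have inL z : z \in C -> z \in L by move=> zC; apply: (subsetP sCL); rewrite in_set.
have cardL : size C + #|L :\: [set x in C]| = #|L|.
  by have := cardsID [set x in C] L; rewrite (setIidPr sCL) cardsE (card_uniqP uC).
have dgLC : dg e L u = count (e u) C + dg e (L :\: [set x in C]) u.
  by rewrite (dgID e [set x in C]) (setIidPr sCL) dg_set.
have cntC : count (e u) C <= 1.
  by apply: count_le1 => // x y xC yC /attu ax /attu ay; apply: (att_inj mC bigC xC yC ax ay).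
have dgP : dg e (L :\: [set x in C]) u <= k * (2 * c + 1).
  case: (pP) => _ uP <-; rewrite dg_set // -sP.
  by apply: count_flatten_le => s sIn; apply: nbr_bound uH; apply: memb; rewrite inE sIn orbT.
have du := dgL_ge2 uH.
have dgk : dg e L u <= 1 + k * (2 * c + 1) by rewrite dgLC; apply: leq_add.
have other (D : seq T) Q y : packing e c Q (L :\: [set z in D]) -> {subset Q <= P} ->
    y \in L :\: [set z in D] -> exists C' P',
    [/\ y \in C', size Q = (size P').+1, packing e c P' (L :\: [set z in D ++ C']),
        {subset P' <= P} & [/\ member C', {in C', forall z, z \in L} & {in D, forall z, z \notin C'}]].
  move=> pQ QP yW; have [C' C'Q yC'] := packing_find pQ yW.
  have perm := perm_to_rem C'Q.
  have [cC' sC' pP'] := packing_uncons (packing_perm perm pQ).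
  have memW z : z \in C' -> z \in L :\: [set z in D] by move=> zC'; apply: (subsetP sC'); rewrite in_set.
  exists C', (rem C' Q); split=> //.
  - by rewrite (perm_size perm).
  - have <- : L :\: [set z in D] :\: [set z in C'] = L :\: [set z in D ++ C'] by
      apply/setP => z; rewrite !in_setD !in_set mem_cat negb_or -!andbA andbCA.
    exact: pP'.
  - by move=> z /mem_rem/QP.
  - split; first by apply: memb; rewrite inE QP ?orbT.
      by move=> z /memW; rewrite in_setD => /andP[].
    by move=> z zD; apply/negP => /memW; rewrite in_setD in_set zD.
have eqrot i (s t : seq T) : rot i s = t -> perm_eq s t by move=> <-; rewrite perm_sym perm_rot.
case: (boolP (has att C)) => [/hasP[x xC ax] | /hasPn natt].
(* [C] has an attached vertex [x]: it is opened there and joined through [H] to another cycle,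
   opened at a neighbour [y] of [u]. *)
- have nattC z : z \in C -> z != x -> ~~ att z.
    by move=> zC; apply: contra => az; apply/eqP; apply: (att_inj mC bigC zC xC az ax).
  have [y yW euy] : exists2 y, y \in L :\: [set x in C] & e u y.
    by apply: dg_gt0; move: du; rewrite dgLC; move: cntC; clear; lia.
  have [C' [P' [yC' sP' pP' _ [mC' subC' dCC']]]] := other C P y pP (fun _ h => h) yW.
  have uC' := member_uniq mC'.
  have [i [s1 [r1 [E0 n1 _ exs]]]] := rot_notatt mC xC ax; have {}E := eqrot _ _ _ E0.
  have [i' [s2 [r2 [E1 n2 pB _]]]] := rot_notatt mC' yC' (attu _ euy); have {}E' := eqrot _ _ _ E1.
  have [u' [p [[pp e1 e2 up] [subH sp]]]] := att_path ax (attu _ euy).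
  have [pA lA] : path e s1 ([:: x] ++ (u' :: p) ++ rev (s2 :: rcons r2 y)) /\
      last s1 ([:: x] ++ (u' :: p) ++ rev (s2 :: rcons r2 y)) = s2.
    apply: path_splice => //; last by rewrite last_rcons.
    by rewrite /= esym exs.
  have nx z : z \in s1 :: r1 -> z \in C /\ z != x.
    move=> zr; rewrite (perm_mem E) in_cons zr orbT; split=> //.
    by have := uC; rewrite (perm_uniq E) cons_uniq => /andP[h _]; apply: contraNneq h => <-.
  have sr1 : size r1 + 2 = size C by rewrite (perm_size E) /= addn2.
  apply: (@no_reroute 1 P' r1 (u' :: p) (C ++ C') s1 _ u pP' _ _ _ pA) => //; rewrite ?lA //.
  - by rewrite add1n -sP'.
  - exact: uniq_catI.
  - by move=> z; rewrite mem_cat => /orP[/inL|/subC'].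
  - apply/permP => b; rewrite !count_cat (permP E b) (permP E' b); clear.
    rewrite -cats1; do 6! rewrite ?(count_cat, count_rev) /=; lia.
  - move=> z zr; have [zC zx] := nx z (mem_behead (s := s1 :: r1) zr).
    by rewrite mem_cat zC; split=> //; apply: nattC.
  - by have [] := nx s1 (mem_head _ _); rewrite mem_cat => ->.
  - by rewrite mem_cat (perm_mem E') !inE eqxx !orbT.
  - have := room_one _ bigC dgk; rewrite -sP sP' => /(_ isT).
    by rewrite -sr1 (addnA (size r1) 1 1) leq_add2r.
have cnt0 : count (e u) C = 0.
  by apply/eqP; rewrite -leqn0 leqNgt -has_count; apply/hasPn => z /natt; apply: contra; apply: attu.
have [x xW eux] : exists2 x, x \in L :\: [set x in C] & e u x.
  by apply: dg_gt0; move: du; rewrite dgLC cnt0; clear; lia.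
have [C' [P' [xC' sP' pP' subP' [mC' subC' dCC']]]] := other C P x pP (fun _ h => h) xW.
have uC' := member_uniq mC'.
have [i [s1 [r1 [E0 n1 pA0 _]]]] := rot_notatt mC' xC' (attu _ eux); have {}E := eqrot _ _ _ E0.
have [y yW /andP[euy neq]] : exists2 y, y \in L :\: [set x in C] & e u y && (y != x).
  have : 0 < dg e ((L :\: [set x in C]) :\ x) u.
    have := dgID e [set x] (L :\: [set x in C]) u.
    have : dg e ((L :\: [set x in C]) :&: [set x]) u <= 1.
      by apply: leq_trans (dg_le _ _ _) _; rewrite -(cards1 x) subset_leq_card // subsetIr.
    by move: du; rewrite dgLC cnt0; clear; lia.
  by case/dg_gt0=> y; rewrite in_setD1 => /andP[neq yW] euy; exists y; rewrite // euy.
have uP (D : seq T) : {subset D <= L} -> u \notin D.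
  by move=> sub; apply/negP => /sub; move: uH; rewrite in_setC => /negbTE->.
case: (boolP (y \in C')) => [yC' | nyC'].
  (* Both neighbours lie on [C']: a detour through [u] spans [C'], and all of [C] is left to absorb
     it. *)
  have : y \in r1.
    have ns1 : y != s1 by apply: contraNneq n1 => <-; apply: attu.
    by move: yC'; rewrite (perm_mem E) !in_cons (negbTE neq) (negbTE ns1).
  move=> yr; case/splitPr: yr E0 E pA0 => a1 [|s2 a2] E0 E pA0.
    have := member_rot i mC'; rewrite E0 => /member_notatt_last.
    by rewrite /= last_cat /= (attu _ euy) (attu _ eux) => /(_ isT).
  have n2 : ~~ att s2.
    have := member_rot (size (x :: s1 :: a1)) (member_rot i mC').
    have {E0}-> : rot i C' = (x :: s1 :: a1) ++ y :: s2 :: a2 by [].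
    rewrite rot_size_cat.
    by move/member_notatt_next; apply; apply: attu.
  move: pA0; rewrite rcons_cat -cat_rcons cat_path => /andP[pA1 /= /andP[_ pB]].
  have [pA lA] : path e s1 (rcons a1 y ++ (u :: [::]) ++ rev (s2 :: rcons a2 x)) /\
      last s1 (rcons a1 y ++ (u :: [::]) ++ rev (s2 :: rcons a2 x)) = s2.
    by apply: path_splice; rewrite ?last_rcons // esym.
  apply: (@no_reroute 1 P' C [:: u] (C ++ C') s1 _ u pP' _ _ _ pA) => //; rewrite ?lA //.
  - by rewrite add1n -sP'.
  - by apply: uniq_catI.
  - by move=> z; rewrite mem_cat => /orP[/inL|/subC'].
  - apply/permP => b; rewrite !count_cat (permP E b); clear.
    rewrite -!cats1; do 6! rewrite ?(count_cat, count_rev) /=; lia.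
  - by move=> z; rewrite inE => /eqP->.
  - by move=> z zC; rewrite mem_cat zC; split=> //; apply: natt.
  - by rewrite mem_cat (perm_mem E) !inE eqxx !orbT.
  - by rewrite mem_cat (perm_mem E) !(inE, mem_cat) eqxx !orbT.
  - have := room_one _ bigC dgk; rewrite -sP sP' => /(_ isT) h.
    by apply: leq_trans (leq_addr 1 _); apply: leq_trans h; apply: leq_addr.
(* The neighbours lie on different cycles: both are opened and joined at [u], so two fans have to be
   split off from [C]. *)
have [C'' [P'' [yC'' sP'' pP'' _ [mC'' subC'' dC'']]]] : exists C'' P'',
    [/\ y \in C'', size P' = (size P'').+1, packing e c P'' (L :\: [set z in (C ++ C') ++ C'']),
        {subset P'' <= P} &
        [/\ member C'', {in C'', forall z, z \in L} & {in C ++ C', forall z, z \notin C''}]].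
  apply: other pP' subP' _; move: (yW); rewrite in_setD in_set => /andP[nyC yL].
  by rewrite in_setD in_set mem_cat negb_or nyC nyC' yL.
have uC'' := member_uniq mC''.
have [j [s2 [r2 [E1 n2 pB0 _]]]] := rot_notatt mC'' yC'' (attu _ euy); have {}E1 := eqrot _ _ _ E1.
have [pA lA] : path e s1 (rcons r1 x ++ (u :: [::]) ++ rev (s2 :: rcons r2 y)) /\
    last s1 (rcons r1 x ++ (u :: [::]) ++ rev (s2 :: rcons r2 y)) = s2.
  by apply: path_splice; rewrite ?last_rcons // esym.
apply: (@no_reroute 2 P'' C [:: u] ((C ++ C') ++ C'') s1 _ u pP'' _ _ _ pA) => //; rewrite ?lA //.
- by rewrite -sP sP' sP''.
- by apply: uniq_catI => //; apply: uniq_catI.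
- by move=> z; rewrite !mem_cat -orbA => /or3P[/inL|/subC'|/subC''].
- apply/permP => b; rewrite !count_cat (permP E b) (permP E1 b); clear.
  rewrite -!cats1; do 6! rewrite ?(count_cat, count_rev) /=; lia.
- by move=> z; rewrite inE => /eqP->.
- by move=> z zC; rewrite !mem_cat zC; split=> //; apply: natt.
- by rewrite !mem_cat (perm_mem E) !inE eqxx !orbT.
- by rewrite !mem_cat (perm_mem E1) !inE eqxx !orbT.
- by have := room_two _ bigC dgk; rewrite -sP sP' sP''; apply.
Qed.

End Maximal.

(** * From maximum packings to indexed families of cycles *)

Lemma uniq_flatten_map (I T : eqType) (F : I -> seq T) (s : seq I) :
  uniq s -> (forall i, uniq (F i)) ->
  (forall i j, i != j -> ~~ has (mem (F j)) (F i)) -> uniq (flatten [seq F i | i <- s]).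
Proof.
move=> us uF dF; elim: s us => //= i s IH /andP[ni us].
rewrite cat_uniq uF IH // andbT; apply/hasPn => x /flatten_mapP[j js xj].
have ij : i != j by apply: contraNneq ni => ->.
by apply: contra (dF i j ij) => /= xi; apply/hasP; exists x.
Qed.

Lemma flatten_disjoint (T : finType) (P : seq (seq T)) i j :
  uniq (flatten P) -> i < j -> j < size P -> [disjoint nth [::] P i & nth [::] P j].
Proof.
elim: P i j => // s P IH [|i] [|j] //= + lt ltj; rewrite cat_uniq => /and3P[_ dis uP].
  rewrite disjoint_sym disjoint_has; apply: contra dis => /hasP[x xj xs].
  by apply/hasP; exists x => //; apply/flattenP; exists (nth [::] P j) => //; apply: mem_nth.
exact: IH.
Qed.

Theorem theorem2 (T : finType) (e : rel T) (k c : nat) :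
  symmetric e -> irreflexive e -> 0 < k -> 0 < c ->
  fkc k c <= #|T| ->
  (exists F : 'I_k -> seq T,
      (forall i, c_chorded e c (F i)) /\
      (forall i j, i != j -> [disjoint F i & F j])) ->
  sigma2_ge e #|T| ->
  exists F : 'I_k -> seq T,
    [/\ forall i, c_chorded e c (F i),
        forall i j, i != j -> [disjoint F i & F j]
      & forall v : T, exists i, v \in F i].
Proof.
move=> esym eirr; case: k => // k _ c0 large [F [chF disF]] sigma.
pose has_card m := exists W, packable e c k.+1 W /\ #|W| = m.
have card0 : has_card #|[set x in flatten [seq F i | i <- enum 'I_k.+1]]|.
  exists [set x in flatten [seq F i | i <- enum 'I_k.+1]]; split=> //.
  exists [seq F i | i <- enum 'I_k.+1]; split; first by rewrite size_map size_enum_ord.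
  split=> //; first by apply/allP => _ /mapP[i _ ->].
  apply: uniq_flatten_map; first exact: enum_uniq.
    by move=> i; apply: c_chorded_uniq (chF i).
  by move=> i j /disF; rewrite disjoint_has.
have le_card m : has_card m -> m <= #|T| by case=> W [_ <-]; apply: max_card.
have [m [[L [packL cardL]] maxm]] := ex_max_nat card0 le_card.
have maxL W : packable e c k.+1 W -> #|W| <= #|L|.
  by move=> pW; rewrite cardL; apply: maxm; exists W.
have [P [sP [chP uP covP]]] := packL; have LT := all_covered esym eirr packL maxL sigma c0 large.
exists (fun i : 'I_k.+1 => nth [::] P i); split.
- by move=> i; apply: (allP chP); rewrite mem_nth // sP.
- move=> i j neq; case: (ltngtP i j) => [lt | lt | /val_inj E].
  + by apply: flatten_disjoint; rewrite ?sP.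
  + by rewrite disjoint_sym; apply: flatten_disjoint; rewrite ?sP.
  + by rewrite E eqxx in neq.
- move=> v; have : v \in [set x in flatten P] by rewrite covP LT in_setT.
  rewrite in_set => /flattenP[s /(nthP [::])[i]]; rewrite sP => lt <- vs.
  by exists (Ordinal lt).
Qed.
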